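(* Let $P$ be a random discrete distribution with exchangeable composition probability function $p^{\rm ex}$. For every distribution of a real random variable $X$ with $\mathbb{E}|X|^n<\infty$, the $n$th moment of $\tilde X_P$, the $P$-mean of a sequence of i.i.d. copies of $X$, is finite and given by $$\mathbb{E}\,\tilde X_P^n=\sum_{k=1}^n\sum_{(n_1,\ldots,n_k)}p^{\rm ex}(n_1,\ldots,n_k)\prod_{i=1}^k\mathbb{E}X^{n_i},$$ where the inner sum is over all $\binom{n-1}{k-1}$ compositions $(n_1,\ldots,n_k)$ of $n$ into $k$ positive parts. In particular, if $\mathbb{E}\exp(tX)<\infty$ for $t$ in some open interval $I$ containing $0$, then for every random discrete distribution $P$: (i) $\mathbb{E}\exp(t\tilde X_P)\le\mathbb{E}\exp(tX)<\infty$ for $t\in I$; (ii) the distribution of $\tilde X_P$ is uniquely determined by its moment sequence, given by the displayed formula for $n=1,2,\ldots$.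
   Context: A random discrete distribution is a sequence $P=(P_1,P_2,\ldots)$ of random variables with $P_j\ge 0$ and $\sum_jP_j=1$ almost surely. The $P$-mean of $X$ is $\tilde X_P=\sum_jX_jP_j$ with $X_1,X_2,\ldots$ i.i.d. copies of $X$, independent of $P$. The exchangeable composition probability function (ECPF) of $P$ is $$p^{\rm ex}(n_1,\ldots,n_k)=\frac{1}{k!}\binom{n}{n_1,\ldots,n_k}p(n_1,\ldots,n_k),\qquad p(n_1,\ldots,n_k)=\sum_{(j_1,\ldots,j_k)}\mathbb{E}\prod_{i=1}^kP_{j_i}^{n_i},$$ where $n=n_1+\cdots+n_k$ and the last sum is over all sequences of $k$ distinct positive integers. *)

(* Defs.v *)
From HB Require Import structures.
From mathcomp Require Import all_boot all_order all_algebra.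
From mathcomp Require Import finmap.
From mathcomp Require Import all_classical all_reals all_analysis.
From mathcomp Require Import measurable_realfun.

Set Implicit Arguments.
Unset Strict Implicit.
Unset Printing Implicit Defensive.

Import Order.TTheory GRing.Theory Num.Theory.
Import numFieldNormedType.Exports.

Local Open Scope classical_set_scope.
Local Open Scope ring_scope.

(* Sequences indexed by the positive integers in the literature are indexed
   by [nat] here: [P j] stands for $P_{j+1}$ and [Y j] for $X_{j+1}$. *)

Section random_sequences.
Context d (T : measurableType d) (R : realType) (Pr : probability T R).
Implicit Types P Y : nat -> {RV Pr >-> R}.

Definition random_discrete_distribution P : Prop :=
  {ae Pr, forall w, (forall j, 0 <= P j w) /\
                    (series (fun j => P j w) @ \oo --> (1 : R))}.

Definition mutually_independent Y : Prop :=
  forall (J : {fset nat}) (B : nat -> set R), (forall j, measurable (B j)) ->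
    (Pr (\bigcap_(j in [set` J]) (Y j @^-1` B j)) =
     \big[*%E/1%E]_(j <- J) Pr (Y j @^-1` B j))%E.

Definition sigma_seq Y : set (set T) :=
  <<s \bigcup_j preimage_set_system [set: T] (Y j) measurable >>.

(* Independence of two whole sequences, not just termwise. *)
Definition independent_seqs Y P : Prop :=
  forall A B : set T, sigma_seq Y A -> sigma_seq P B ->
    Pr (A `&` B) = (Pr A * Pr B)%E.

(* Only the law of [X] matters, so [X] may live on another space. *)
Definition iid_copies Y d' (T' : measurableType d') (Q : probability T' R)
    (X : {RV Q >-> R}) : Prop :=
  mutually_independent Y /\
  forall (j : nat) (A : set R), measurable A ->
    distribution Pr (Y j) A = distribution Q X A.

(* The sum is meaningful only where the series converges; off that set [limn]
   returns a fixed default value. *)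
Definition P_mean P Y (w : T) : R :=
  limn (series (fun j => Y j w * P j w)).

Lemma measurable_P_mean P Y : measurable_fun [set: T] (P_mean P Y).
Proof.
pose S n w : R := series (fun j => Y j w * P j w) n.
have mS n : measurable_fun [set: T] (S n).
  rewrite /S /series /=; apply: measurable_sum => j.
  by apply: measurable_funM; exact: measurable_funPT.
pose C := [set w | cvgn (S ^~ w)].
have CE : C = \bigcap_k \bigcup_N \bigcap_n
    ((fun w => S (N + n)%N w - S N w) @^-1` [set x : R | `|x| < k.+1%:R^-1]).
  apply/seteqP; split=> w.
    move=> /cauchy_cvgP /cauchy_ballP cS k _.
    have k0 : 0 < (k.+1%:R^-1 : R) by rewrite invr_gt0.
    have [[A B] /= [[N1 _ N1A] [N2 _ N2B]] AB] := cS _ k0.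
    exists (maxn N1 N2) => // n _ /=.
    suff : ball (S (maxn N1 N2 + n)%N w) k.+1%:R^-1 (S (maxn N1 N2) w).
      by rewrite -ball_normE.
    apply: (AB (_, _)); split => /=.
      by apply: N1A => /=; rewrite (leq_trans (leq_maxl _ _) (leq_addr _ _)).
    by apply: N2B => /=; rewrite leq_maxr.
  move=> h; apply/cauchy_cvgP/cauchy_exP => e e0.
  have [N _ hN] := h (Num.truncn e^-1) I.
  exists (S N w); exists N => // n /= Nn.
  rewrite -ball_normE /= distrC -(subnKC Nn).
  apply: lt_trans (hN (n - N)%N I) _.
  by rewrite invf_plt ?posrE// truncnS_gt.
have mC : measurable C.
  rewrite CE; apply: bigcap_measurable => // k _.
  apply: bigcup_measurable => N _; apply: bigcap_measurable => // n _.
  have mB : measurable_fun [set: T] (fun w => `|S (N + n)%N w - S N w|).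
    by apply: measurableT_comp => //; exact: measurable_funB.
  rewrite -[X in measurable X]setTI.
  rewrite [X in _ `&` X](_ : _ = (fun w => `|S (N + n)%N w - S N w|) @^-1`
    `]-oo, k.+1%:R^-1[%classic); last first.
    by apply/seteqP; split=> w /=; rewrite in_itv.
  exact: mB.
have dvgE w : ~ C w -> P_mean P Y w = point by exact: dvgP.
apply: (@measurable_fun_cvg _ _ _ _
  (fun n w => if w \in C then S n w else point)).
  move=> n; apply: measurable_fun_ifT => //.
  by apply: (measurable_fun_bool true); rewrite setTI [X in measurable X](_ : _ = C)//;
    apply/seteqP; split=> w /=; [exact: set_mem|exact: mem_set].
move=> w _; have [Cw|nCw] := pselect (C w).
  by rewrite mem_set//; exact: Cw.
by rewrite memNset// dvgE//; exact: cvg_cst.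
Qed.

HB.instance Definition _ P Y :=
  isMeasurableFun.Build _ _ _ _ (P_mean P Y) (measurable_P_mean P Y).

(* $p(m_0,\ldots,m_{k-1})=\sum_j E \prod_i P_{j_i}^{m_i}$ over sequences
   $j$ of distinct indices, i.e. injective maps. *)
Definition partition_sum P k (m : 'I_k -> nat) : \bar R :=
  (\esum_(j in [set j : {ffun 'I_k -> nat} | injective j])
    'E_Pr[fun w => (\prod_(i < k) P (j i) w ^+ m i)%R])%E.

Definition ECPF P k (m : 'I_k -> nat) : \bar R :=
  ((k`!%:R^-1 * ((\sum_(i < k) m i)`!%:R / \prod_(i < k) (m i)`!%:R))%:E
   * partition_sum P m)%E.

End random_sequences.

(* Parts of a composition of [n] are at most [n], so [{ffun 'I_k -> 'I_n.+1}]
   contains every composition of [n] into [k] parts. *)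
Definition is_composition n k (c : {ffun 'I_k -> 'I_n.+1}) : bool :=
  [forall i, (0 < c i)%N] && (\sum_(i < k) c i == n)%N.

(* The right-hand side of the $n$th moment formula, for $n\ge 1$. *)
Definition ECPF_moment d (T : measurableType d) (R : realType)
    (Pr : probability T R) (P : nat -> {RV Pr >-> R})
    d' (T' : measurableType d') (Q : probability T' R) (X : {RV Q >-> R})
    (n : nat) : \bar R :=
  (\sum_(1 <= k < n.+1) \sum_(c : {ffun 'I_k -> 'I_n.+1} | is_composition c)
     ECPF P (fun i => c i : nat)
     * \big[*%E/1]_(i < k) 'E_Q[fun w => (X w ^+ c i)%R])%E.

Definition determined_by_moments (R : realType) (mu : probability R R) : Prop :=
  (forall n : nat, mu.-integrable [set: R] (fun x => (x ^+ n)%:E)) /\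
  forall nu : probability R R,
    (forall n : nat, nu.-integrable [set: R] (fun x => (x ^+ n)%:E)) ->
    (forall n : nat, \int[nu]_x (x ^+ n)%:E = \int[mu]_x (x ^+ n)%:E)%E ->
    forall A : set R, measurable A -> nu A = mu A.

(* Main.v *)
(* The moment formula comes from the truncations S_N = \sum_(j < N) Y_j P_j:
   expand S_N^n by the multinomial theorem, factor each expectation by
   independence, and regroup the exponent vectors by the size k of their
   support, each support being numbered in k! ways.  By Jensen's inequality
   |S_N|^n is dominated by the weighted sum of the |Y_j|^n with weights P_j,
   whose expectation is E|X|^n, so dominated convergence gives the limit.
   Jensen's inequality (as a tangent-line inequality) also gives (i).

   For (ii), let mu have exponential moments and let nu have the same moments.
   Then nu has exponential moments too, since 2 cosh(s x) is a series of even
   moments with nonnegative terms.  The functions f such that \int p f dmu =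
   \int p f dnu for every polynomial p contain the constants and are stable
   under multiplication by cos(w (x - c)) for small w (expand the cosine in its
   Taylor series, dominated by an exponential).  Hence mu and nu integrate alike
   every polynomial in cos(w (x - c)); bounded limits of those give the
   indicator of {cos(w (x - c)) >= cos(w d)}, which tends to that of
   [c - d, c + d] as w tends to 0. *)
From HB Require Import structures.
Require Import Defs.
From mathcomp Require Import all_boot all_order all_algebra.
From mathcomp Require Import finmap ring lra.
From mathcomp Require Import all_classical all_reals all_analysis.
From mathcomp Require Import measurable_realfun.

Set Implicit Arguments.
Unset Strict Implicit.
Unset Printing Implicit Defensive.

Import Order.TTheory GRing.Theory Num.Theory.
Import numFieldNormedType.Exports.

Local Open Scope ring_scope.

(** * Multinomial expansion grouped by support *)

(** Coefficient comparison: [e y] is the exponential series of [y 'X] truncated at degree [n], and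
    up to that degree the product of the [e (x i)] has the coefficients of the exponential of the
    sum. *)
Lemma multinomial_expansion (F : numFieldType) (N n : nat) (x : 'I_N -> F) :
  (\sum_(i < N) x i) ^+ n =
  \sum_(a : {ffun 'I_N -> 'I_n.+1} | (\sum_(i < N) a i == n)%N)
    n`!%:R * \prod_(i < N) (x i ^+ a i / (a i)`!%:R).
Proof.
have factN0 m : (m`!)%:R != 0 :> F by rewrite pnatr_eq0 -lt0n fact_gt0.
pose e (y : F) : {poly F} := \poly_(m < n.+1) (y ^+ m / m`!%:R).
have coef_prod_e M (y : 'I_M -> F) m : (m <= n)%N ->
    (\prod_(i < M) e (y i))`_m = (\sum_(i < M) y i) ^+ m / m`!%:R.
  elim: M y m => [|M IH] y m mn.
    rewrite !big_ord0 coef1 expr0n; case: m mn => [|m] _ /=.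
      by rewrite divr1.
    by rewrite mul0r.
  rewrite !big_ord_recr /= coefM exprDn mulr_suml.
  rewrite [RHS](reindex_inj rev_ord_inj) /=.
  apply: eq_bigr => i _; rewrite IH; last first.
    by rewrite (leq_trans _ mn)// -ltnS.
  rewrite coef_poly ltnS (leq_trans (leq_subr _ _) mn).
  have im : (i <= m)%N by rewrite -ltnS.
  rewrite subSS subKn// -[X in X / m`!%:R]mulr_natr bin_sub//.
  have -> : 'C(m, i)%:R = m`!%:R / (i`!%:R * (m - i)`!%:R) :> F.
    by rewrite -(bin_fact im) natrM natrM mulfK ?mulf_neq0 ?factN0.
  field; rewrite !factN0 //.
apply: (mulIf (invr_neq0 (factN0 n))).
rewrite -coef_prod_e// big_distrl/=.
have -> : \prod_(i < N) e (x i) = \sum_(a : {ffun 'I_N -> 'I_n.+1})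
   (\prod_(i < N) (x i ^+ a i / (a i)`!%:R)) *: 'X^(\sum_(i < N) a i).
  under eq_bigr do rewrite /e poly_def.
  rewrite bigA_distr_bigA; apply: eq_bigr => a _.
  rewrite -prodrXr scaler_prod //.
rewrite coef_sum [RHS]big_mkcond/=; apply: eq_bigr => a _.
rewrite coefZ coefXn eq_sym; case: eqVneq => _; last by rewrite mulr0.
by rewrite mulr1 mulrC mulrA mulVf ?mul1r.
Qed.

Section regroup.
Context {N n k : nat}.
Implicit Types (a : {ffun 'I_N -> 'I_n.+1}) (c : {ffun 'I_k -> 'I_n.+1})
  (j : {ffun 'I_k -> 'I_N}).

(** When [j] is injective, [pick] has at most one candidate, so this is [c] transported along [j]
    and extended by zero. *)
Definition exponents j c : {ffun 'I_N -> 'I_n.+1} :=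
  [ffun x => if [pick i | j i == x] is Some i then c i else ord0].

Definition exponent_support a : {set 'I_N} := [set x | (0 < a x)%N].

Lemma exponentsE j c i : injective j -> exponents j c (j i) = c i.
Proof.
by move=> ij; rewrite ffunE; case: pickP => [i' /eqP/ij ->//|/(_ i)]; rewrite eqxx.
Qed.

Lemma exponents0 j c x : x \notin codom j -> exponents j c x = ord0.
Proof.
move=> jx; rewrite ffunE; case: pickP => // i /eqP ix.
by move: jx; rewrite -ix codom_f.
Qed.

Lemma big_exponents (V : Type) (idx : V) (op : Monoid.com_law idx)
    (phi : 'I_N -> nat -> V) j c : injective j -> (forall x, phi x 0%N = idx) ->
  \big[op/idx]_(x < N) phi x (exponents j c x) =
  \big[op/idx]_(i < k) phi (j i) (c i).
Proof.
move=> ij phi0; rewrite (bigID (mem (codom j)))/=.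
rewrite [X in op _ X]big1 ?Monoid.mulm1; last first.
  by move=> x jx; rewrite exponents0.
rewrite -(big_uniq _ (_ : uniq (codom j)))/=; last by rewrite map_inj_uniq// enum_uniq.
by rewrite big_map big_enum; apply: eq_bigr => i _; rewrite exponentsE.
Qed.

(** An injection of a set of size [k] into another one is onto, so the condition on the image
    reduces to taking values in [A]; such injections are counted by a falling factorial. *)
Lemma count_numberings (A : {set 'I_N}) : #|A| = k ->
  #|[set j : {ffun 'I_k -> 'I_N} | injectiveb j && (A == [set x in codom j])]|
  = k`!.
Proof.
move=> Ak; have -> : k`! = #|A| ^_ #|'I_k| by rewrite Ak card_ord ffactnn.
rewrite -card_inj_ffuns_on.
apply: eq_card => j; rewrite !inE; apply/andP/andP => -[].
  move=> ij /eqP ->; split=> //; apply/ffun_onP => i.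
  by rewrite inE codom_f.
move=> /ffun_onP jA ij; split=> //; rewrite eq_sym eqEcard; apply/andP; split.
  by apply/fintype.subsetP => x; rewrite inE => /codomP[i ->].
by rewrite cardsE card_codom ?card_ord ?Ak//; exact/injectiveP.
Qed.

(** Once the numbering [j] of the support is fixed, [exponents j] is a bijection from positive
    compositions onto the vectors with that support; its inverse is composition with [j]. *)
Lemma sum_exponents (W : nmodType) (V : {ffun 'I_N -> 'I_n.+1} -> W) j :
  injective j ->
  \sum_(a : {ffun 'I_N -> 'I_n.+1} |
    (\sum_x a x == n)%N && (exponent_support a == [set x in codom j])) V a
  = \sum_(c : {ffun 'I_k -> 'I_n.+1} |
      [forall i, (0 < c i)%N] && (\sum_i c i == n)%N) V (exponents j c).
Proof.
move=> ij.
rewrite (reindex_onto (exponents j) (fun a : {ffun 'I_N -> 'I_n.+1} =>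
  [ffun i => a (j i)] : {ffun 'I_k -> 'I_n.+1})) /=.
  apply: eq_bigl => c; rewrite (big_exponents _ (phi := fun=> id))//.
  have -> : ([ffun i => exponents j c (j i)] : {ffun 'I_k -> 'I_n.+1}) == c by
    apply/eqP/ffunP => i; rewrite ffunE exponentsE.
  rewrite andbT andbC; congr (_ && _).
  apply/eqP/forallP => [/setP h i|c0].
    by have := h (j i); rewrite !inE exponentsE// codom_f.
  apply/setP => x; rewrite !inE; have [/codomP[i ->]|xj] := boolP (x \in codom j).
    by rewrite exponentsE// c0.
  by rewrite exponents0.
move=> a /andP[_ /eqP /setP aj]; apply/ffunP => x.
have [/codomP[i ->]|xj] := boolP (x \in codom j).
  by rewrite exponentsE// ffunE.
rewrite exponents0//; have := aj x; rewrite !inE (negbTE xj).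
by move=> /negbT; rewrite -eqn0Ngt => /eqP ax; apply/val_inj.
Qed.

End regroup.

(* Each exponent vector with support of size k arises from exactly k! pairs
   (numbering of the support, composition). *)
Lemma sum_by_support (F : numFieldType) (N n : nat)
    (V : {ffun 'I_N -> 'I_n.+1} -> F) : (0 < n)%N ->
  \sum_(a : {ffun 'I_N -> 'I_n.+1} | (\sum_(x < N) a x == n)%N) V a =
  \sum_(1 <= k < n.+1)
    \sum_(c : {ffun 'I_k -> 'I_n.+1} |
          [forall i, (0 < c i)%N] && (\sum_(i < k) c i == n)%N)
      \sum_(j : {ffun 'I_k -> 'I_N} | injectiveb j)
        k`!%:R^-1 * V (exponents j c).
Proof.
move=> n0.
(* Positivity of [n] excludes the empty support, and each index in the support contributes at least
   1 to the total [n]. *)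
have suppn (a : {ffun 'I_N -> 'I_n.+1}) : (\sum_x a x == n)%N ->
    (0 < #|exponent_support a| < n.+1)%N.
  move=> /eqP an; rewrite ltnS; apply/andP; split.
    rewrite card_gt0; apply: contraTneq n0 => /setP a0.
    rewrite -an big1// => x _; have := a0 x; rewrite !inE.
    by move=> /negbT; rewrite -eqn0Ngt => /eqP.
  rewrite -[leqRHS]an -sum1_card [in leqRHS](bigID (mem (exponent_support a)))/=.
  rewrite (leq_trans _ (leq_addr _ _))//; apply: leq_sum => x.
  by rewrite inE.
transitivity (\sum_(1 <= k < n.+1) \sum_(a : {ffun 'I_N -> 'I_n.+1} |
    (\sum_(x < N) a x == n)%N && (#|exponent_support a| == k)) V a).
  rewrite (exchange_big_dep (fun a : {ffun 'I_N -> 'I_n.+1} =>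
    (\sum_x a x == n)%N))/=; last by move=> k a _ /andP[].
  apply: eq_bigr => a an; have /andP[s0 sn] := suppn a an.
  rewrite -big_filter (_ : [seq _ <- _ | _] = [:: #|exponent_support a|]) ?big_seq1//.
  rewrite -(@filter_pred1_uniq _ (index_iota 1 n.+1)) ?mem_index_iota ?iota_uniq ?s0//.
  by apply: eq_filter => i /=; rewrite an eq_sym.
apply: eq_bigr => k _.
rewrite exchange_big/=.
under [RHS]eq_bigr => j /injectiveP ij.
  rewrite -(sum_exponents (fun a : {ffun 'I_N -> 'I_n.+1} => k`!%:R^-1 * V a))//.
  over.
(* After the exchange each vector occurs once per numbering of its support, and this number cancels
   the inverse factorial. *)
rewrite (exchange_big_dep (fun a : {ffun 'I_N -> 'I_n.+1} =>
  (\sum_(x < N) a x == n)%N && (#|exponent_support a| == k)))/=; last first.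
  move=> j a /injectiveP ij /andP[-> /eqP ->].
  by rewrite cardsE card_codom ?card_ord ?eqxx//.
apply: eq_bigr => a /andP[an /eqP ak].
rewrite sumr_const.
rewrite (_ : #|_| = k`!); last first.
  rewrite -(count_numberings ak); apply: eq_card => j.
  by rewrite !inE an.
by rewrite -mulrnAl -mulr_natl mulfV ?mul1r// pnatr_eq0 -lt0n fact_gt0.
Qed.

Local Open Scope classical_set_scope.
Local Open Scope ring_scope.

(** * Determinacy of the moment problem under exponential moments *)

Section real_bounds.
Context {R : realType}.
Implicit Types (x y u : R).

Lemma exprn_le_expR y n : 0 <= y -> y ^+ n <= n`!%:R * expR y.
Proof.
move=> y0; rewrite mulrC -ler_pdivrMr ?ltr0n ?fact_gt0//.
case: n => [|n]; last by rewrite (le_trans _ (expR_ge1Dxn n y0))// lerDr.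
by rewrite expr0 divr1 -expR0 ler_expR.
Qed.

(** Induction along Horner's scheme: half of the rate [e] bounds the polynomial of lower degree, the
    other half absorbs the new factor [x]. *)
Lemma horner_le_expR (p : {poly R}) (e : R) : 0 < e ->
  exists2 K, 0 <= K & forall x, `|p.[x]| <= K * expR (e * `|x|).
Proof.
elim/poly_ind: p e => [|p c IH] e e0.
  by exists 0 => // x; rewrite horner0 normr0 mul0r.
have h0 : 0 < e / 2 by rewrite divr_gt0.
have [K K0 HK] := IH _ h0.
exists (K * (e / 2)^-1 + `|c|).
  by rewrite addr_ge0// mulr_ge0// invr_ge0 ltW.
move=> x; rewrite hornerMXaddC (le_trans (ler_normD _ _))// mulrDl lerD//.
  rewrite normrM -mulrA.
  have -> : expR (e * `|x|) = expR (e / 2 * `|x|) * expR (e / 2 * `|x|).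
    by rewrite -expRD; congr expR; field.
  rewrite [leRHS](_ : _ = (K * expR (e / 2 * `|x|)) *
    ((e / 2)^-1 * expR (e / 2 * `|x|))); last by ring.
  rewrite ler_pM// ler_pdivlMl//.
  rewrite -[X in X <= _]expr1 (le_trans (exprn_le_expR 1 _))//.
    by rewrite mulr_ge0// ltW.
  by rewrite mul1r.
by rewrite ler_peMr// -expR0 ler_expR mulr_ge0// ltW.
Qed.

Lemma expR_norm_le x : expR `|x| <= expR x + expR (- x).
Proof.
by have [?|?] := ger0P x; rewrite ?lerDl ?lerDr ?expR_ge0.
Qed.

(** Each cosine coefficient is zero or, up to sign, an exponential coefficient. The bound is uniform
    in [n], as dominated convergence requires. *)
Lemma series_cos_coeff_le x n : `|series (cos_coeff x) n| <= expR `|x|.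
Proof.
apply: (@le_trans _ _ (series (exp_coeff `|x|) n)).
  rewrite (le_trans (ler_norm_sum _ _ _))// ler_sum// => i _.
  rewrite /cos_coeff /exp_coeff /= !normrM normfV normr_nat !normrX normrN1 expr1n.
  case: odd; rewrite /= ?normr0 ?normr1 ?mul0r ?mul1r ?mulr1
    ?divr_ge0 ?exprn_ge0 ?normr_nat//.
rewrite /expR; apply: nondecreasing_cvgn_le; last first.
  exact: is_cvg_series_exp_coeff.
apply/nondecreasing_seqP => k; rewrite seriesSr lerDl.
by rewrite exp_coeff_ge0.
Qed.

Lemma cvg_series_cos_coeff x : series (cos_coeff x) @ \oo --> cos x.
Proof. by rewrite unlock; exact: is_cvg_series_cos_coeff. Qed.

(** With [q] the square root of [r], [n q^n] is at most the geometric sum of the [q^i] for [i < n],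
    hence bounded; the remaining factor [q^n] tends to zero. *)
Lemma cvg_nat_mulX (r : R) : 0 <= r < 1 -> (fun n => n%:R * r ^+ n) @ \oo --> (0 : R).
Proof.
move=> /andP[r0 r1]; set q := Num.sqrt r.
have q0 : 0 <= q by rewrite sqrtr_ge0.
have q1 : q < 1 by rewrite -sqrtr1 ltr_sqrt.
have nq n : n%:R * q ^+ n <= (1 - q)^-1.
  rewrite -[leRHS]mul1r ler_pdivlMr ?subr_gt0//.
  have -> : n%:R * q ^+ n * (1 - q) = \sum_(i < n) (q ^+ n * (1 - q)).
    by rewrite sumr_const card_ord -mulr_natl; ring.
  apply: (@le_trans _ _ (\sum_(i < n) (q ^+ i * (1 - q)))).
    apply: ler_sum => i _; rewrite ler_wpM2r ?subr_ge0 ?(ltW q1)//.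
    by rewrite ler_wiXn2l ?(ltW q1) ?(ltnW (ltn_ord i)).
  rewrite -mulr_suml mulrC -opprB mulNr -subrX1 opprB lerBlDr lerDl exprn_ge0//.
apply: (@squeeze_cvgr _ _ _ _ (fun=> 0) (geometric (1 - q)^-1 q)).
- near=> n; rewrite mulr_ge0 ?exprn_ge0//= -(sqr_sqrtr r0) -/q -exprM mulnC exprM.
  by rewrite expr2 mulrA ler_wpM2r ?exprn_ge0.
- exact: cvg_cst.
- by apply: cvg_geometric; rewrite ger0_norm.
Unshelve. all: by end_near. Qed.

(* The exponent M = N 2^N makes M u^N = N (2 u)^N vanish in the limit for
   u < 1/2 and at least N for u >= 1/2; the factor N settles u = 1/2. *)
Lemma cvg_indicator_ge_half u : 0 <= u <= 1 ->
  (fun N => 1 - (1 - u ^+ N) ^+ (N * 2 ^ N)) @ \oo --> ((2^-1 <= u)%R%:R : R).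
Proof.
move=> /andP[u0 u1].
have uN N : 0 <= u ^+ N <= 1 by rewrite exprn_ge0// exprn_ile1.
have -> : ((2^-1 <= u)%R%:R : R) = 1 - (u < 2^-1)%R%:R.
  by rewrite ltNge; case: (2^-1 <= u); rewrite ?subr0 ?subrr.
apply: cvgB; first exact: cvg_cst.
have [uh|uh] := ltP u 2^-1.
  apply: (@squeeze_cvgr _ _ _ _ (fun N => 1 - N%:R * (2 * u) ^+ N) (fun=> 1)).
  - near=> N; apply/andP; split; last first.
      have /andP[a b] := uN N.
      by rewrite exprn_ile1// ?subr_ge0// gerBl.
    have /andP[a b] := uN N.
    (* Bernoulli's inequality. *)
    have B M : 1 - M%:R * u ^+ N <= (1 - u ^+ N) ^+ M.
      elim: M => [|M IH]; first by rewrite mul0r subr0 expr0.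
      rewrite exprSr (le_trans _ (ler_wpM2r _ IH)) ?subr_ge0//.
      rewrite -natr1; set v := u ^+ N in a b *.
      have : 0 <= M%:R * v * v by rewrite !mulr_ge0.
      lra.
    apply: le_trans (B _); rewrite natrM exprMn natrX mulrA//.
  - rewrite -[X in _ --> X]subr0; apply: cvgB; first exact: cvg_cst.
    by apply: cvg_nat_mulX; lra.
  - exact: cvg_cst.
apply: (@squeeze_cvgr _ _ _ _ (fun=> 0) harmonic).
- near=> N; have /andP[a b] := uN N; rewrite exprn_ge0 ?subr_ge0//=.
  (* By [1 - v <= expR (- v)] the power is at most the inverse of [expR (N (2 u)^N)], which is at
     most [1 / (N + 1)] since [2 u >= 1]. *)
  have : 1 - u ^+ N <= expR (- u ^+ N) by exact: expR_ge1Dx.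
  move=> /(lerXn2r (N * 2 ^ N)); rewrite !nnegrE subr_ge0 b expR_ge0 => /(_ isT isT).
  move=> /le_trans; apply.
  rewrite -expRM_natl mulrN expRN lef_pV2 ?posrE ?expR_gt0//.
  rewrite (le_trans _ (expR_ge1Dx _))// -natr1 addrC lerD2l natrM -mulrA.
  rewrite ler_peMr// natrX -exprMn exprn_ege1//; lra.
- exact: cvg_cst.
- exact: cvg_harmonic.
Unshelve. all: by end_near. Qed.

End real_bounds.

(** * Test functions on which two laws with equal moments agree *)

Section moment_determinacy.
Context {R : realType}.
Implicit Types (mu nu : probability R R) (s w c : R) (f : R -> R).

Definition exp_moment mu s := mu.-integrable [set: R] (fun x => (expR (s * `|x|))%:E).

Lemma exp_moment_integrable mu s f K : exp_moment mu s ->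
  measurable_fun [set: R] f -> (forall x, `|f x| <= K * expR (s * `|x|)) ->
  mu.-integrable [set: R] (EFin \o f).
Proof.
move=> es mf fK; apply: (le_integrable _ _ _ (integrableZl _ K es)) => //.
  exact/measurable_EFinP.
move=> x _ /=; rewrite lee_fin (le_trans (fK x))//; exact: ler_norm.
Qed.

Lemma exp_moment_horner mu s (p : {poly R}) : 0 < s -> exp_moment mu s ->
  mu.-integrable [set: R] (fun x => (p.[x])%:E).
Proof.
move=> s0 es; have [K K0 HK] := horner_le_expR p s0.
apply: (exp_moment_integrable es _ HK).
by apply: continuous_measurable_fun; exact: continuous_horner.
Qed.

(** The polynomial factor makes the class stable under multiplication by a cosine, whose Taylor
    polynomials are absorbed into [p]; the bound on [f] keeps these products integrable. *)
Definition moment_blind mu nu f :=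
  [/\ measurable_fun [set: R] f, exists B, forall x, `|f x| <= B &
  forall p : {poly R}, (\int[mu]_x (p.[x] * f x)%:E = \int[nu]_x (p.[x] * f x)%:E)%E].

Lemma moment_blind_integrable mu s f p : 0 < s -> exp_moment mu s ->
  measurable_fun [set: R] f -> (exists B, forall x, `|f x| <= B) ->
  mu.-integrable [set: R] (fun x => (p.[x] * f x)%:E).
Proof.
move=> s0 es mf [B fB]; have [K K0 HK] := horner_le_expR p s0.
apply: (exp_moment_integrable (s := s) (K := K * B)) => //.
  apply: measurable_funM => //.
  by apply: continuous_measurable_fun; exact: continuous_horner.
by move=> x; rewrite normrM mulrAC ler_pM.
Qed.

Section closure.
Variables (mu nu : probability R R) (s : R).
Hypotheses (s0 : 0 < s) (mus : exp_moment mu s) (nus : exp_moment nu s).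

Lemma moment_blind_cst b :
  (forall n, \int[mu]_x (x ^+ n)%:E = \int[nu]_x (x ^+ n)%:E)%E ->
  moment_blind mu nu (fun=> b).
Proof.
move=> munu; split; [exact: measurable_cst|by exists `|b| |move=> p].
have E (l : probability R R) : exp_moment l s -> (\int[l]_x (p.[x] * b)%:E =
    \sum_(i < size p) (p`_i * b)%:E * \int[l]_x (x ^+ i)%:E)%E.
  move=> ls; have iX i : l.-integrable [set: R] (fun x => (x ^+ i)%:E).
    apply: eq_integrable (exp_moment_horner ('X^i) s0 ls) => // x _.
    by rewrite hornerXn.
  under eq_integral => x _.
    rewrite horner_coef mulr_suml -sumEFin.
    under eq_bigr do rewrite mulrAC EFinM.
    over.
  rewrite integral_sum//=; last by move=> i; exact: integrableZl.
  by apply: eq_bigr => i _; rewrite integralZl.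
by rewrite !E//; apply: eq_bigr => i _; rewrite munu.
Qed.

Lemma moment_blindD f g : moment_blind mu nu f -> moment_blind mu nu g ->
  moment_blind mu nu (fun x => f x + g x).
Proof.
move=> [mf [B fB] fE] [mg [C gC] gE]; split.
- exact: measurable_funD.
- by exists (B + C) => x; rewrite (le_trans (ler_normD _ _))// lerD.
- move=> p; under eq_integral do rewrite mulrDr EFinD.
  rewrite integralD//; last 2 first.
  + by apply: moment_blind_integrable mus mf _; last by exists B.
  + by apply: moment_blind_integrable mus mg _; last by exists C.
  under [RHS]eq_integral do rewrite mulrDr EFinD.
  rewrite integralD//; last 2 first.
  + by apply: moment_blind_integrable nus mf _; last by exists B.
  + by apply: moment_blind_integrable nus mg _; last by exists C.
  by rewrite fE gE.
Qed.

Lemma moment_blindZ f b : moment_blind mu nu f ->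
  moment_blind mu nu (fun x => b * f x).
Proof.
move=> [mf [B fB] fE]; split.
- exact: measurable_funM.
- by exists (`|b| * B) => x; rewrite normrM ler_wpM2l.
- move=> p; have := fE (b *: p).
  under eq_integral do rewrite hornerZ -mulrA mulrCA.
  by under [RHS]eq_integral do rewrite hornerZ -mulrA mulrCA.
Qed.

(** For the Taylor polynomials [q n] of the cosine, [p * q n] is again a polynomial, so the
    hypothesis on [f] applies for each [n]; dominated convergence then gives the limit. *)
Lemma moment_blind_cos f w c : 0 <= w < s -> moment_blind mu nu f ->
  moment_blind mu nu (fun x => cos (w * (x - c)) * f x).
Proof.
move=> /andP[w0 ws] [mf [B fB] fE].
have mc : measurable_fun [set: R] (fun x => cos (w * (x - c))).
  apply: continuous_measurable_fun => x.
  apply: continuous_comp; last exact: continuous_cos.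
  by apply: cvgM; [exact: cvg_cst|apply: cvgB; [exact: cvg_id|exact: cvg_cst]].
split.
- exact: measurable_funM.
- by exists B => x; rewrite normrM (le_trans _ (fB x))// ler_piMl// cos_max.
move=> p.
pose q n : {poly R} := \sum_(0 <= i < n)
  ((~~ odd i)%:R * (-1) ^+ i./2 / i`!%:R) *: (w *: ('X - c%:P)) ^+ i.
have qE n x : (q n).[x] = series (cos_coeff (w * (x - c))) n.
  rewrite /q /series /= horner_sum; apply: eq_bigr => i _.
  by rewrite /cos_coeff hornerZ horner_exp hornerZ hornerXsubC /= mulrAC.
have sw : 0 < s - w by rewrite subr_gt0.
(* The rate [s] is split into [s - w] for [p] and [w] for the Taylor polynomials; the shift by [c]
   costs the constant factor [expR (w |c|)]. *)
have [K K0 HK] := horner_le_expR p sw.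
have lim (l : probability R R) : exp_moment l s ->
    (\int[l]_x ((p * q n).[x] * f x)%:E)%E @[n --> \oo] -->
    (\int[l]_x (p.[x] * (cos (w * (x - c)) * f x))%:E)%E.
  move=> ls.
  have [| | | | |_ _ +] := @dominated_convergence _ _ _ l setT measurableT
    (fun n x => ((p * q n).[x] * f x)%:E)
    (fun x => (p.[x] * (cos (w * (x - c)) * f x))%:E)
    (fun x => (K * B * expR (w * `|c|) * expR (s * `|x|))%:E).
  - move=> n; apply/measurable_EFinP; apply: measurable_funM => //.
    by apply: continuous_measurable_fun; exact: continuous_horner.
  - apply/measurable_EFinP; apply: measurable_funM; last exact: measurable_funM.
    by apply: continuous_measurable_fun; exact: continuous_horner.
  - apply: aeW => x _; apply: cvg_EFin; first exact: nearW.
    rewrite /comp/=; under eq_cvg do rewrite hornerM qE -mulrA.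
    apply: cvgM; first exact: cvg_cst.
    by apply: cvgM; [exact: cvg_series_cos_coeff|exact: cvg_cst].
  - exact: (integrableZl measurableT (K * B * expR (w * `|c|)) ls).
  - apply: aeW => x n _; rewrite /= lee_fin hornerM qE !normrM.
    rewrite [leRHS](_ : _ = K * expR ((s - w) * `|x|) *
        expR (w * `|c| + w * `|x|) * B); last first.
      rewrite (_ : s * `|x| = (s - w) * `|x| + w * `|x|); last by ring.
      by rewrite !expRD; ring.
    rewrite ler_pM ?mulr_ge0// ler_pM//.
    rewrite (le_trans (series_cos_coeff_le _ _))// ler_expR.
    rewrite normrM ger0_norm// -mulrDr ler_wpM2l//.
    by rewrite (le_trans (ler_normB _ _))// addrC.
  - by [].
rewrite -(cvg_lim _ (lim _ mus))// -(cvg_lim _ (lim _ nus))//.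
by congr (limn _); apply/funext => n; exact: fE.
Qed.

End closure.
End moment_determinacy.

(** * From level sets of cosines to segments and Borel sets *)

Section moment_determinacy_conclusion.
Context {R : realType}.
Variables (mu nu : probability R R) (s : R).
Hypotheses (s0 : 0 < s) (mus : exp_moment mu s) (nus : exp_moment nu s).
Hypothesis munu : forall n, (\int[mu]_x (x ^+ n)%:E = \int[nu]_x (x ^+ n)%:E)%E.

Lemma moment_blind_horner_cos (q : {poly R}) (a b w c : R) : 0 <= w < s ->
  moment_blind mu nu (fun x => q.[a + b * cos (w * (x - c))]).
Proof.
move=> ws; elim/poly_ind: q => [|q e IH].
  by under eq_fun do rewrite horner0; exact: (moment_blind_cst s0).
under eq_fun do rewrite hornerMXaddC [_ * (a + _)]mulrC mulrDl -[b * _ * _]mulrA.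
apply: (moment_blindD s0) => //; last exact: (moment_blind_cst s0).
apply: (moment_blindD s0) => //; first exact: moment_blindZ.
by apply: moment_blindZ; exact: (moment_blind_cos mus nus).
Qed.

Lemma measurable_cos_level (t w c : R) :
  measurable [set x : R | t <= cos (w * (x - c))].
Proof.
have mc : measurable_fun [set: R] (fun x => cos (w * (x - c))).
  apply: continuous_measurable_fun => x.
  apply: continuous_comp; last exact: continuous_cos.
  by apply: cvgM; [exact: cvg_cst|apply: cvgB; [exact: cvg_id|exact: cvg_cst]].
rewrite -[X in measurable X]setTI.
rewrite [X in _ `&` X](_ : _ = (fun x => cos (w * (x - c))) @^-1` `[t, +oo[).
  exact: mc.
by apply/seteqP; split => x /=; rewrite in_itv/= andbT.
Qed.

(** Dominated convergence with the constant 1. It serves both for polynomials in a cosine and for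
    indicators of level sets. *)
Lemma cvg_bounded_probability (l : probability R R) (f : nat -> R -> R) (A : set R) :
  measurable A -> (forall n, measurable_fun [set: R] (f n)) ->
  (forall n x, `|f n x| <= 1) -> (forall x, f ^~ x @ \oo --> (\1_A x : R)) ->
  (\int[l]_x (f n x)%:E)%E @[n --> \oo] --> l A.
Proof.
move=> mA mf f1 fA.
have [| | | | |_ _ +] := @dominated_convergence _ _ _ l setT measurableT
  (fun n x => (f n x)%:E) (fun x => (\1_A x)%:E) (fun=> 1%E).
- by move=> n; exact/measurable_EFinP.
- by apply/measurable_EFinP.
- by apply: aeW => x _; apply: cvg_EFin; [exact: nearW|exact: fA].
- exact: finite_measure_integrable_cst.
- by apply: aeW => x n _; rewrite /= lee_fin.
- by rewrite integral_indic// setIT.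
Qed.

Lemma cos_level_eq (t w c : R) : 0 <= w < s -> -1 <= t <= 1 ->
  mu [set x | t <= cos (w * (x - c))] = nu [set x | t <= cos (w * (x - c))].
Proof.
move=> ws t1.
pose q N : {poly R} := 1 - (1 - 'X^N) ^+ (N * 2 ^ N).
(* This affine function of the cosine has values in [[0, 1]] because [t] is in [[-1, 1]], and it
   sends the threshold [t] to 1/2. *)
pose u x := (2^-1 - t / 4) + 4^-1 * cos (w * (x - c)).
have u01 x : 0 <= u x <= 1.
  have := cos_le1 (w * (x - c)); have := cos_geN1 (w * (x - c)).
  by rewrite /u; lra.
have qE N x : (q N).[u x] = 1 - (1 - u x ^+ N) ^+ (N * 2 ^ N).
  by rewrite /q !hornerE.
have blind N := moment_blind_horner_cos (q N) (2^-1 - t / 4) 4^-1 c ws.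
have lim (l : probability R R) : (\int[l]_x ((q n).[u x])%:E)%E @[n --> \oo] -->
    l [set x | t <= cos (w * (x - c))].
  apply: cvg_bounded_probability.
  - exact: measurable_cos_level.
  - by move=> n; have [] := blind n.
  - move=> n x; rewrite qE; have /andP[a b] := u01 x.
    have h : 0 <= (1 - u x ^+ n) ^+ (n * 2 ^ n) <= 1.
      by rewrite exprn_ge0 ?exprn_ile1 ?subr_ge0 ?gerBl ?exprn_ge0 ?exprn_ile1.
    by rewrite ler_norml; lra.
  - move=> x; under eq_cvg do rewrite qE.
    rewrite (_ : \1__ x = (2^-1 <= u x)%R%:R).
      exact: cvg_indicator_ge_half.
    rewrite indicE; congr ((nat_of_bool _)%:R); apply/idP/idP.
      by rewrite inE/= /u; lra.
    by rewrite inE/= /u; lra.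
rewrite -(cvg_lim _ (lim mu))// -(cvg_lim _ (lim nu))//.
congr (limn _); apply/funext => n.
have [_ _ /(_ 1)] := blind n.
by under eq_integral do rewrite hornerC mul1r;
  under [RHS]eq_integral do rewrite hornerC mul1r.
Qed.

Lemma segment_eq (a b : R) : a <= b -> mu `[a, b]%classic = nu `[a, b]%classic.
Proof.
move=> ab; pose c := (a + b) / 2; pose d := (b - a) / 2.
(* Frequencies tending to zero; the shift by two keeps them below [s] already for [n = 0]. *)
pose w n := s / n.+2%:R.
have ws n : 0 <= w n < s.
  by rewrite divr_ge0 ?(ltW s0)//= ltr_pdivrMr// ltr_pMr// ltr1n.
have w0 n : 0 < w n by rewrite divr_gt0.
have d0 : 0 <= d by rewrite divr_ge0// subr_ge0.
pose A n := [set x | cos (w n * d) <= cos (w n * (x - c))].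
have lim (l : probability R R) : l (A n) @[n --> \oo] --> l `[a, b]%classic.
  have lE n : l (A n) = (\int[l]_x (\1_(A n) x)%:E)%E.
    by rewrite integral_indic ?setIT//; exact: measurable_cos_level.
  under eq_fun do rewrite lE.
  apply: cvg_bounded_probability => //.
  - by move=> n; apply: measurable_indic; exact: measurable_cos_level.
  - by move=> n x; rewrite indicE; case: (x \in _); rewrite ?normr1 ?normr0.
  - move=> x.
    (* Once both angles lie in [[0, pi]], where the cosine is strictly decreasing, the level
       condition at [x] reads [|x - c| <= d]; hence the indicators are eventually constant at each
       [x]. *)
    have wpi y : \forall n \near \oo, w n * `|y| <= pi.
      near=> n; rewrite /w mulrAC ler_pdivrMr// [leRHS]mulrC -ler_pdivrMr ?pi_gt0//.
      apply: (@le_trans _ _ n%:R); last by rewrite ler_nat -addn2 leq_addr.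
      near: n; exact: nbhs_infty_ger.
    apply: cvg_near_cst; near=> n; rewrite !indicE; congr ((nat_of_bool _)%:R).
    suff : (cos (w n * d) <= cos (w n * (x - c))) = (x \in `[a, b]).
      by move=> E; apply/idP/idP; rewrite !inE/= ?E// -E.
    rewrite -[cos (w n * (x - c))](_ : cos (w n * `|x - c|) = _); last first.
      by have [?|?] := ger0P (x - c); rewrite // mulrN cosN.
    have pd : w n * d <= pi by rewrite -(ger0_norm d0); near: n; exact: wpi.
    have px : w n * `|x - c| <= pi by near: n; exact: wpi.
    have pd0 : 0 <= w n * d by rewrite mulr_ge0// ltW.
    have px0 : 0 <= w n * `|x - c| by rewrite mulr_ge0// ltW.
    rewrite leNgt ltr_cos ?in_itv/= ?pd0 ?px0//.
    rewrite -leNgt ler_pM2l// ler_norml ?in_itv/= /c /d.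
    by apply/idP/idP; lra.
rewrite -(cvg_lim _ (lim mu))// -(cvg_lim _ (lim nu))//.
congr (limn _); apply/funext => n; apply: cos_level_eq => //.
by rewrite cos_le1 cos_geN1.
Unshelve. all: by end_near. Qed.

(** The rays [[x, +oo[] are stable under intersection and generate the Borel sets, and each is the
    increasing union of the segments [[x, x + n]]. *)
Lemma exp_moment_unique (B : set R) : measurable B -> mu B = nu B.
Proof.
pose G : set (set R) := @RGenCInfty.G R.
apply: (@measure_unique _ _ _ G (fun n => `[- n%:R, +oo[%classic)).
- exact: (RGenCInfty.measurableE R).
- move=> _ _ [x ->] [y ->]; exists (Num.max x y).
  apply/seteqP; split => z /=; rewrite !in_itv/= !andbT ge_max.
    by move=> [-> ->].
  by move=> /andP[].
- by move=> i; exists (- i%:R).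
- apply/seteqP; split => // x _.
  exists (Num.bound `|x|) => //=; rewrite in_itv/= andbT lerNl.
  by rewrite (le_trans _ (ltW (archi_boundP (normr_ge0 x))))// -normrN ler_norm.
- move=> _ [x ->].
  have E : `[x, +oo[%classic = \bigcup_n `[x, x + n%:R]%classic.
    apply/seteqP; split => y /=; rewrite in_itv/= andbT => xy.
      exists (Num.bound (y - x)) => //=; rewrite in_itv/= xy/= -lerBlDl.
      by rewrite ltW// archi_boundP// subr_ge0.
    by move: xy => [n _] /=; rewrite in_itv/= => /andP[].
  have lim (l : probability R R) :
      l `[x, x + n%:R]%classic @[n --> \oo] --> l `[x, +oo[%classic.
    rewrite E; apply: nondecreasing_cvg_mu => //.
      exact: bigcup_measurable.
    apply/nondecreasing_seqP => n; apply/subsetPset => y /=; rewrite !in_itv/=.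
    by move=> /andP[-> /le_trans] /=; apply; rewrite lerD2l ler_nat.
  apply: (etrans (esym (cvg_lim _ (lim mu))) (etrans _ (cvg_lim _ (lim nu)))) => //.
  by congr (limn _); apply/funext => n; apply: segment_eq; rewrite lerDl.
- by move=> k; rewrite (le_lt_trans (probability_le1 _ _))// ltry.
Qed.

End moment_determinacy_conclusion.

(** * Transfer of exponential moments between laws with equal moments *)

Section determined.
Context {R : realType}.

(** These are the terms of the series of [2 cosh x]: odd ones cancel, even ones are even powers.
    Their sign allows exchanging series and integral. *)
Lemma exp_coeffDN_ge0 (x : R) k : 0 <= exp_coeff x k + exp_coeff (- x) k.
Proof.
rewrite /exp_coeff/= -mulrDl mulr_ge0 ?invr_ge0// exprNn -signr_odd.
have [k1|k0] := boolP (odd k); first by rewrite expr1 mulN1r subrr.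
by rewrite expr0 mul1r addr_ge0 ?exprn_even_ge0.
Qed.

Lemma nneseries_exp_coeffDN (x : R) :
  (\sum_(k <oo) (exp_coeff x k + exp_coeff (- x) k)%:E)%E = (expR x + expR (- x))%:E.
Proof.
apply/cvg_lim => //.
under eq_fun do rewrite sumEFin.
apply: cvg_EFin; first exact: nearW.
rewrite /comp/=; under eq_cvg do rewrite big_split/=.
by apply: cvgD; exact: is_cvg_series_exp_coeff.
Qed.

(** The functions [expR (s |x|)] and [2 cosh (s x)] bound each other up to a factor 2; the second
    one has an integral expressible through moments. *)
Lemma exp_moment_ltyP (mu : probability R R) (s : R) : 0 < s ->
  exp_moment mu s <-> (\int[mu]_x (expR (s * x) + expR (- (s * x)))%:E < +oo)%E.
Proof.
move=> s0.
have m2 : measurable_fun [set: R] (fun x => expR (s * x) + expR (- (s * x))).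
  apply: measurable_funD; apply: measurableT_comp => //; last apply: measurable_funN;
    exact: measurable_funM.
have m1 : measurable_fun [set: R] (fun x => expR (s * `|x|)).
  by apply: measurableT_comp => //; exact: measurable_funM.
split=> [es|h].
  apply: integrable_lty => //.
  apply: (exp_moment_integrable (K := 2) es) => // x.
  rewrite ger0_norm ?addr_ge0 ?expR_ge0// mulr2n mulrDl mul1r.
  by rewrite lerD// ler_expR -?mulrN ler_pM2l// ?ler_norm// -normrN ler_norm.
apply/integrableP; split; first exact/measurable_EFinP.
apply: le_lt_trans h; apply: ge0_le_integral => //.
- by apply: measurableT_comp => //; exact/measurable_EFinP.
- exact/measurable_EFinP.
- move=> x _; rewrite /= lee_fin ger0_norm ?expR_ge0//.
  by rewrite -[X in X * `|x|]ger0_norm ?(ltW s0)// -normrM expR_norm_le.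
Qed.

Lemma exp_moment_determined (mu : probability R R) (s : R) : 0 < s ->
  exp_moment mu s -> determined_by_moments mu.
Proof.
move=> s0 mus.
have iX n : mu.-integrable [set: R] (fun x => (x ^+ n)%:E).
  apply: eq_integrable (exp_moment_horner ('X^n) s0 mus) => // x _.
  by rewrite hornerXn.
split=> // nu iXnu munu A mA.
apply/esym; apply: (exp_moment_unique s0 mus) => //.
apply/exp_moment_ltyP => //; move/exp_moment_ltyP : mus => /(_ s0).
suff -> : (\int[nu]_x (expR (s * x) + expR (- (s * x)))%:E =
  \int[mu]_x (expR (s * x) + expR (- (s * x)))%:E)%E by [].
(* Termwise integration of nonnegative terms: the integral of [2 cosh (s x)] depends on the moments
   alone, so its finiteness passes from [mu] to [nu]. *)
have E (l : probability R R) :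
    (forall n, l.-integrable setT (fun x : R => (x ^+ n)%:E)) ->
  (\int[l]_x (expR (s * x) + expR (- (s * x)))%:E =
   \sum_(k <oo) (exp_coeff s k + exp_coeff (- s) k)%:E * \int[l]_x (x ^+ k)%:E)%E.
  move=> il; under eq_integral do rewrite -nneseries_exp_coeffDN.
  rewrite integral_nneseries//=.
  - apply: eq_eseriesr => k _; rewrite -integralZl//; apply: eq_integral => x _.
    by rewrite -EFinM /exp_coeff/= -mulNr !exprMn; congr EFin; ring.
  - move=> k; apply/measurable_EFinP; apply: measurable_funD;
      apply: measurable_funM => //; apply: measurable_funX => //;
      last apply: measurable_funN; exact: measurable_funM.
  - by move=> k x _; rewrite lee_fin exp_coeffDN_ge0.
by rewrite !E//; apply: eq_eseriesr => k _; rewrite munu.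
Qed.

End determined.

(** * Independence *)

Section independence.
Context d (T : measurableType d) (R : realType) (Pr : probability T R).
Implicit Types (f g : {RV Pr >-> R}) (Y : nat -> {RV Pr >-> R}).

Definition indep_rv f g := forall A B : set R, measurable A -> measurable B ->
  Pr (f @^-1` A `&` g @^-1` B) = (Pr (f @^-1` A) * Pr (g @^-1` B))%E.

Lemma indep_rv_ge0_integral f g (phi : R * R -> \bar R) : indep_rv f g ->
  measurable_fun [set: R * R] phi -> (forall z, 0 <= phi z)%E ->
  (\int[Pr]_w phi (f w, g w) =
   \int[distribution Pr f \x distribution Pr g]_z phi z)%E.
Proof.
move=> fg mphi phi0.
have mh : measurable_fun [set: T] (fun w => (f w, g w)) by exact: measurable_fun_pair.
pose H := isMeasurableFun.Build _ _ _ _ (fun w => (f w, g w)) mh.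
pose h : {mfun T >-> (R * R)%type} := HB.pack (fun w => (f w, g w)) H.
rewrite -(ge0_integral_distribution (P := Pr) h mphi phi0).
apply: eq_measure_integral => A mA _; symmetry.
by apply: product_measure_unique => // B C mB mC; exact: fg.
Qed.

(** The joint law is the product of the marginal laws, so Fubini's theorem on the plane separates
    the factors. *)
Lemma indep_rv_integralM f g : indep_rv f g ->
  Pr.-integrable [set: T] (EFin \o f) -> Pr.-integrable [set: T] (EFin \o g) ->
  Pr.-integrable [set: T] (fun w => (f w * g w)%:E) /\
  (\int[Pr]_w (f w * g w)%:E = (\int[Pr]_w (f w)%:E) * (\int[Pr]_w (g w)%:E))%E.
Proof.
move=> fg fi gi.
set m1 := distribution Pr f; set m2 := distribution Pr g.
have mM : measurable_fun [set: R * R] (fun z : R * R => (z.1 * z.2)%:E).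
  by apply/measurable_EFinP; apply: measurable_funM.
have mid : measurable_fun [set: R] (EFin : R -> \bar R) by exact/measurable_EFinP.
have i1 : m1.-integrable [set: R] (EFin : R -> \bar R) by exact: integrable_pushforward.
have i2 : m2.-integrable [set: R] (EFin : R -> \bar R) by exact: integrable_pushforward.
have E1 : (\int[m1]_x x%:E = \int[Pr]_w (f w)%:E)%E by rewrite integral_distribution.
have E2 : (\int[m2]_x x%:E = \int[Pr]_w (g w)%:E)%E by rewrite integral_distribution.
(* Integrability by Tonelli: the integral of [|x y|] is the product of two finite absolute
   moments. *)
have iM : (m1 \x m2)%E.-integrable [set: R * R] (fun z : R * R => (z.1 * z.2)%:E).
  apply/integrable12ltyP => //=.
  rewrite [ltLHS](_ : _ = \int[m1]_x (`|x%:E| * \int[m2]_y `|y%:E|))%E; last first.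
    apply: eq_integral => x _; rewrite -ge0_integralZl//; last exact: measurableT_comp.
    by apply: eq_integral => y _; rewrite -abseM.
  rewrite ge0_integralZr//; last 2 first.
  - exact: measurableT_comp.
  - by apply: integral_ge0 => ? _; exact: abse_ge0.
  move/integrableP : i1 => [_ i1]; move/integrableP : i2 => [_ i2].
  by rewrite lte_mul_pinfty ?ge0_fin_numE ?integral_ge0.
have iP : Pr.-integrable [set: T] (fun w => (f w * g w)%:E).
  apply/integrableP; split.
    by apply/measurable_EFinP; exact: measurable_funM.
  rewrite (indep_rv_ge0_integral (phi := fun z => `|(z.1 * z.2)%:E|%E) fg) //.
  - by have /integrableP[] := iM.
  - exact: measurableT_comp.
split=> //.
have mh : measurable_fun [set: T] (fun w => (f w, g w)) by exact: measurable_fun_pair.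
pose H := isMeasurableFun.Build _ _ _ _ (fun w => (f w, g w)) mh.
pose h : {mfun T >-> (R * R)%type} := HB.pack (fun w => (f w, g w)) H.
transitivity (\int[distribution Pr h]_z (z.1 * z.2)%:E)%E.
  by rewrite integral_distribution.
transitivity (\int[m1 \x m2]_z (z.1 * z.2)%:E)%E.
  apply: eq_measure_integral => A mA _; symmetry.
  by apply: product_measure_unique => // B C mB mC; exact: fg.
rewrite -integral12_prod_meas1//= /fubini_F/=.
under eq_integral => x _.
  under eq_integral do rewrite EFinM.
  rewrite integralZl// E2.
  over.
rewrite /= -E1.
have /fineK <- : (\int[Pr]_w (g w)%:E)%E \is a fin_num by exact: integrable_fin_num.
by rewrite integralZr.
Qed.

(** For fixed [D] both sides are finite measures in [A], a restriction and a multiple of [Pr];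
    agreeing on the pi-system [G], they agree on the sigma-algebra it generates. *)
Lemma indep_g_sigma_algebra (G : set (set T)) (D : set T) :
  G `<=` measurable -> setI_closed G -> G setT -> measurable D ->
  (forall A, G A -> Pr (A `&` D) = Pr A * Pr D)%E ->
  forall A, <<s G >> A -> (Pr (A `&` D) = Pr A * Pr D)%E.
Proof.
move=> Gm GI GT mD GD A sA.
have D0 : (0 <= fine (Pr D))%R by rewrite fine_ge0.
have E B : mscale (NngNum D0) Pr B = (Pr B * Pr D)%E.
  by rewrite /mscale/= fineK ?fin_num_measure// muleC.
rewrite -E -[LHS]/(mrestr Pr mD A).
apply: (@g_sigma_algebra_measure_unique _ _ _ G Gm (fun=> setT)) => //.
- exact: bigcup_const.
- by move=> B /GD BD; rewrite [RHS]E -BD.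
- move=> _; rewrite /= /mrestr setTI.
  by rewrite (le_lt_trans (probability_le1 _ _))// ltry.
Qed.

(** The usual closure rules for measurable functions are applied on [T] equipped with [<<s G >>] in
    place of its own sigma-algebra. *)
Lemma g_sigma_algebra_preimage_prod (G : set (set T)) (F : nat -> T -> R)
    (a : nat -> nat) N :
  (forall i, (i < N)%N -> forall B, measurable B -> <<s G >> (F i @^-1` B)) ->
  forall B, measurable B -> <<s G >> ((fun w => \prod_(i < N) F i w ^+ a i) @^-1` B).
Proof.
move=> FG B mB.
have : @measurable_fun _ _ (g_sigma_algebraType G) R setT
    (fun w => \prod_(i < N) F i w ^+ a i).
  apply: measurable_prod => i _; apply: measurable_funX.
  by move=> _ C mC; rewrite setTI; exact: FG.
by move=> /(_ measurableT B mB); rewrite setTI.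
Qed.

Lemma mutually_independent_ord Y N (B : nat -> set R) :
  mutually_independent Y -> (forall j, measurable (B j)) ->
  (Pr (\bigcap_(i in `I_N) Y i @^-1` B i) = \prod_(i < N) Pr (Y i @^-1` B i))%E.
Proof.
move=> hY mB; have := hY [fset i in iota 0 N]%fset B mB.
rewrite (_ : [set` _] = `I_N); last first.
  by apply/seteqP; split => i /=; rewrite !inE/= mem_iota.
move=> ->; rewrite -(big_mkord xpredT (fun i => Pr (Y i @^-1` B i))).
apply: perm_big; apply: uniq_perm.
- exact: fset_uniq.
- exact: iota_uniq.
- by move=> i; rewrite !inE mem_index_iota mem_iota.
Qed.

(** A named function can carry the measurability instance that makes it a random variable; exponents
    on all of [nat] allow induction on [N]. *)
Definition rv_prod Y (a : nat -> nat) N : T -> R := fun w => \prod_(i < N) Y i w ^+ a i.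

Lemma measurable_rv_prod Y a N : measurable_fun [set: T] (rv_prod Y a N).
Proof. by apply: measurable_prod => i _; exact: measurable_funX. Qed.

HB.instance Definition _ Y a N :=
  isMeasurableFun.Build _ _ _ _ (rv_prod Y a N) (measurable_rv_prod Y a N).

Definition rv_exp (f : {RV Pr >-> R}) n : T -> R := fun w => f w ^+ n.

Lemma measurable_rv_exp f n : measurable_fun [set: T] (rv_exp f n).
Proof. exact: measurable_funX. Qed.

HB.instance Definition _ f n :=
  isMeasurableFun.Build _ _ _ _ (rv_exp f n) (measurable_rv_exp f n).

(** The cylinders over the first [N] variables form a pi-system, each of them is independent of the
    events of [Y N], and the product is measurable for the sigma-algebra they generate. *)
Lemma indep_rv_prod_next Y a N : mutually_independent Y ->
  indep_rv (rv_prod Y a N : {RV Pr >-> R}) (rv_exp (Y N) (a N) : {RV Pr >-> R}).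
Proof.
move=> hY A B mA mB.
pose G := [set E | exists2 C : nat -> set R, (forall i, measurable (C i)) &
  E = \bigcap_(i in `I_N) Y i @^-1` C i].
have mYC i (C : set R) : measurable C -> measurable (Y i @^-1` C).
  by move=> mC; exact: measurable_funPTI.
apply: (@indep_g_sigma_algebra G).
- move=> E [C mC ->]; apply: fin_bigcap_measurable => // i _; exact: mYC.
- move=> _ _ [C mC ->] [D mD ->]; exists (fun i => C i `&` D i).
    by move=> i; exact: measurableI.
  by rewrite -bigcapI.
- by exists (fun=> setT) => //; apply/seteqP; split.
- exact: measurable_funPTI.
- move=> E [C mC ->].
  have mB' : measurable ((fun x : R => x ^+ a N) @^-1` B).
    by rewrite -[X in measurable X]setTI; exact: measurable_funX.
  (* Storing the event of [Y N] at place [N] turns the intersection into a cylinder over [N + 1]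
     variables, to which mutual independence applies. *)
  pose C' i := if i == N then (fun x : R => x ^+ a N) @^-1` B else C i.
  have mC' i : measurable (C' i) by rewrite /C'; case: eqP.
  have -> : rv_exp (Y N) (a N) @^-1` B = Y N @^-1` C' N by rewrite /C' eqxx.
  have CC' : \bigcap_(i in `I_N) Y i @^-1` C i = \bigcap_(i in `I_N) Y i @^-1` C' i.
    by apply: eq_bigcapr => i /= iN; rewrite /C' ltn_eqF.
  rewrite CC' -(bigcap_set1 (fun i => Y i @^-1` C' i) N) -bigcap_setU.
  rewrite (_ : _ `|` _ = `I_N.+1); last by rewrite IIS setUC.
  by rewrite bigcap_set1 !mutually_independent_ord// big_ord_recr.
- apply: (@g_sigma_algebra_preimage_prod G (fun i => Y i) a N) => // i iN C mC.
  apply: sub_sigma_algebra; exists (fun j => if j == i then C else setT).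
    by move=> j; case: eqP.
  apply/seteqP; split => [w Cw j _|w /(_ i iN)]; last by rewrite /= eqxx.
  by case: eqP => [->|].
Qed.

Lemma mutually_independent_integral_prod Y a N : mutually_independent Y ->
  (forall i, (i < N)%N -> Pr.-integrable [set: T] (fun w => (Y i w ^+ a i)%:E)) ->
  Pr.-integrable [set: T] (fun w => (rv_prod Y a N w)%:E) /\
  (\int[Pr]_w (rv_prod Y a N w)%:E = \prod_(i < N) \int[Pr]_w (Y i w ^+ a i)%:E)%E.
Proof.
move=> hY; elim: N => [|N IH] iY.
  under eq_fun do rewrite /rv_prod big_ord0.
  split; first exact: finite_measure_integrable_cst.
  have := integral_cst Pr measurableT 1%E.
  by rewrite big_ord0/= => ->; rewrite probability_setT mule1.
have [|iN EN] := IH; first by move=> i iN; exact/iY/ltnW.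
have E w : rv_prod Y a N.+1 w = rv_prod Y a N w * rv_exp (Y N) (a N) w.
  by rewrite /rv_prod big_ord_recr.
have [] := indep_rv_integralM (indep_rv_prod_next (Y := Y) a N hY) iN (iY N (ltnSn N)).
under eq_fun do rewrite -E.
move=> ? h; split=> //; rewrite big_ord_recr/= -EN -h.
by apply: eq_integral => w _; rewrite E.
Qed.

Lemma independent_seqs_prod Y P a b N : independent_seqs Y P ->
  indep_rv (rv_prod Y a N : {RV Pr >-> R}) (rv_prod P b N : {RV Pr >-> R}).
Proof.
move=> hYP A B mA mB; apply: hYP;
    [apply: (@g_sigma_algebra_preimage_prod _ (fun i => Y i) a N)
    |apply: (@g_sigma_algebra_preimage_prod _ (fun i => P i) b N)] => // i iN C mC;
  apply: sub_sigma_algebra; exists i => //; exists C => //; exact: setTI.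
Qed.

End independence.

(** * Tangent-line inequalities behind Jensen's inequality *)

Section convexity.
Context {R : realType}.
Implicit Types (x y m t : R).

(** In the induction, multiplying by [y] leaves the nonnegative excess [(n + 1) m^n (y - m)^2] over
    the next tangent. *)
Lemma exprn_tangent_le m y n : 0 <= m -> 0 <= y ->
  m ^+ n.+1 + n.+1%:R * m ^+ n * (y - m) <= y ^+ n.+1.
Proof.
move=> m0 y0; elim: n => [|n IH]; first by rewrite expr0; lra.
rewrite [leRHS]exprS; apply: le_trans (ler_wpM2l y0 IH).
rewrite -subr_ge0 [leRHS](_ : _ = n.+1%:R * m ^+ n * (y - m) ^+ 2).
  by apply: mulr_ge0; rewrite ?sqr_ge0// mulr_ge0 ?exprn_ge0.
by rewrite -[n.+2%:R]natr1 !exprS; ring.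
Qed.

(** The tangents at [m] are summed with weights [p j]. Total weight [q] at most 1 suffices: the sum
    exceeds [m^(n + 1)] by [n m^(n + 1) (1 - q)]. *)
Lemma expr_sum_convex (p y : nat -> R) N n : (forall j, 0 <= p j) ->
  \sum_(0 <= j < N) p j <= 1 -> (forall j, 0 <= y j) ->
  (\sum_(0 <= j < N) p j * y j) ^+ n.+1 <= \sum_(0 <= j < N) p j * y j ^+ n.+1.
Proof.
move=> p0 p1 y0; set m := \sum_(_ <= _ < _) _ * y _.
have m0 : 0 <= m by apply: sumr_ge0 => j _; rewrite mulr_ge0.
apply: (@le_trans _ _ (\sum_(0 <= j < N)
    p j * (m ^+ n.+1 + n.+1%:R * m ^+ n * (y j - m)))).
  rewrite (eq_bigr (fun j => m ^+ n.+1 * p j +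
    (n.+1%:R * m ^+ n * (p j * y j) - n.+1%:R * m ^+ n * m * p j))); last first.
    by move=> j _; ring.
  rewrite big_split/= sumrB -!mulr_sumr -/m; set q := \sum_(_ <= _ < _) p _ in p1 *.
  rewrite -subr_ge0 [leRHS](_ : _ = n%:R * (m ^+ n.+1 * (1 - q))).
    by rewrite !mulr_ge0 ?exprn_ge0 ?subr_ge0.
  by rewrite -natr1 exprS; ring.
by apply: ler_sum => j _; rewrite ler_wpM2l// exprn_tangent_le.
Qed.

Lemma expR_tangent_le t m y : expR (t * m) * (1 + t * (y - m)) <= expR (t * y).
Proof.
rewrite (_ : t * y = t * m + t * (y - m)); last by ring.
by rewrite expRD ler_wpM2l ?expR_ge0// expR_ge1Dx.
Qed.

End convexity.

Section iid_integrals.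
Context d (T : measurableType d) (R : realType) (Pr : probability T R).
Context d' (T' : measurableType d') (Q : probability T' R) (X : {RV Q >-> R}).
Implicit Types (Y P : nat -> {RV Pr >-> R}) (phi psi : R -> R).

Lemma iid_copies_integral Y phi j : iid_copies Y X ->
  measurable_fun [set: R] phi ->
  Q.-integrable [set: T'] (fun w => (phi (X w))%:E) ->
  Pr.-integrable [set: T] (fun w => (phi (Y j w))%:E) /\
  (\int[Pr]_w (phi (Y j w))%:E = \int[Q]_w (phi (X w))%:E)%E.
Proof.
move=> [_ hY] mphi iX.
have mE : measurable_fun [set: R] (EFin \o phi) by exact/measurable_EFinP.
have iY : Pr.-integrable [set: T] (fun w => (phi (Y j w))%:E).
  apply/integrableP; split.
    by apply/measurable_EFinP; exact: measurableT_comp.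
  rewrite -(ge0_integral_distribution (P := Pr) (Y j)
    (f := fun x => `|(phi x)%:E|%E))//; last exact: measurableT_comp.
  rewrite (eq_measure_integral (distribution Q X)); last by move=> A mA _; exact: hY.
  rewrite ge0_integral_distribution//; last exact: measurableT_comp.
  by move/integrableP : iX => [].
split=> //.
rewrite -(integral_distribution (P := Pr) (X := Y j) (f := EFin \o phi))//.
rewrite (eq_measure_integral (distribution Q X)); last by move=> A mA _; exact: hY.
by rewrite integral_distribution.
Qed.

Lemma independent_seqs_integralM Y P phi psi j : independent_seqs Y P ->
  measurable_fun [set: R] phi -> measurable_fun [set: R] psi ->
  Pr.-integrable [set: T] (fun w => (phi (Y j w))%:E) ->
  Pr.-integrable [set: T] (fun w => (psi (P j w))%:E) ->
  (\int[Pr]_w (phi (Y j w) * psi (P j w))%:E =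
   (\int[Pr]_w (phi (Y j w))%:E) * (\int[Pr]_w (psi (P j w))%:E))%E.
Proof.
move=> hYP mphi mpsi iY iP.
pose F1 := isMeasurableFun.Build _ _ _ _ (phi \o Y j)
  (measurableT_comp mphi (measurable_funPT (Y j))).
pose f : {RV Pr >-> R} := HB.pack (phi \o Y j) F1.
pose G1 := isMeasurableFun.Build _ _ _ _ (psi \o P j)
  (measurableT_comp mpsi (measurable_funPT (P j))).
pose g : {RV Pr >-> R} := HB.pack (psi \o P j) G1.
have fg : indep_rv f g.
  move=> A B mA mB; apply: hYP; apply: sub_sigma_algebra; exists j => //.
    exists (phi @^-1` A); last exact: setTI.
    by rewrite -[X in measurable X]setTI; exact (mphi measurableT A mA).
  exists (psi @^-1` B); last exact: setTI.
  by rewrite -[X in measurable X]setTI; exact (mpsi measurableT B mB).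
exact: (indep_rv_integralM fg iY iP).2.
Qed.

End iid_integrals.

(** * P-means *)

Section P_means.
Context d (T : measurableType d) (R : realType) (Pr : probability T R).
Context (P : nat -> {RV Pr >-> R}) (hP : random_discrete_distribution P).
Context d' (T' : measurableType d') (Q : probability T' R) (X : {RV Q >-> R}).
Context (Y : nat -> {RV Pr >-> R}) (hY : iid_copies Y X) (hYP : independent_seqs Y P).

Lemma integral_ae_le1 (f : T -> R) : measurable_fun [set: T] f ->
  {ae Pr, forall w, `|f w| <= 1} -> (\int[Pr]_w (f w)%:E <= 1)%E.
Proof.
move=> mf f1; have mE := (measurable_EFinP (R := R) setT f).2 mf.
apply: (le_trans (lee_abs _)); apply: (le_trans (le_abse_integral _ measurableT mE)).
apply: (@le_trans _ _ (\int[Pr]_w (cst 1%E) w)%E).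
  apply: ae_ge0_le_integral => //.
    exact: measurableT_comp.
  by apply: filterS f1 => w fw _; rewrite /= lee_fin.
by rewrite integral_cst//= probability_setT mule1.
Qed.

Lemma integrable_ae_le1 (f : T -> R) : measurable_fun [set: T] f ->
  {ae Pr, forall w, `|f w| <= 1} -> Pr.-integrable [set: T] (EFin \o f).
Proof.
move=> mf f1; have mE := (measurable_EFinP (R := R) setT f).2 mf.
apply/integrableP; split=> //=.
apply: le_lt_trans (ltry 1); apply: (@integral_ae_le1 (fun w => `|f w|)).
  exact: measurableT_comp.
by apply: filterS f1 => w; rewrite normr_id.
Qed.

Lemma ae_weights : {ae Pr, forall w, [/\ forall j, 0 <= P j w,
  forall N, \sum_(0 <= j < N) P j w <= 1 &
  series (fun j => P j w) @ \oo --> (1 : R)]}.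
Proof.
apply: filterS hP => w [P0 P1]; split=> // N.
rewrite -(cvg_lim _ P1)//.
apply: (@nondecreasing_cvgn_le _ (series (fun j => P j w))); last exact: cvgP P1.
by apply/nondecreasing_seqP => k; rewrite seriesSr lerDl.
Qed.

Lemma ae_weight_le1 j : {ae Pr, forall w, `|P j w| <= 1}.
Proof.
apply: filterS ae_weights => w [P0 P1 _]; rewrite ger0_norm//.
apply: le_trans (P1 j.+1); rewrite big_nat_recr//= lerDr.
by apply: sumr_ge0 => i _.
Qed.

Lemma integrable_weight j : Pr.-integrable [set: T] (fun w => `|P j w|%:E).
Proof.
apply: integrable_ae_le1; first exact: measurableT_comp.
by apply: filterS (ae_weight_le1 j) => w; rewrite normr_id.
Qed.

Lemma ae_weights_total : {ae Pr, forall w, (\sum_(j <oo) `|P j w|%:E = 1)%E}.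
Proof.
apply: filterS ae_weights => w [P0 _ P1]; apply/cvg_lim => //.
under eq_fun do rewrite sumEFin.
apply: cvg_EFin; first exact: nearW.
rewrite /comp/=; under eq_cvg do under eq_bigr do rewrite ger0_norm//.
exact: P1.
Qed.

Lemma weights_total_integral : (\sum_(j <oo) \int[Pr]_w `|P j w|%:E = 1)%E.
Proof.
have mP j : measurable_fun [set: T] (fun w => `|P j w|%:E).
  by apply/measurable_EFinP; exact: measurableT_comp.
rewrite -integral_nneseries//.
rewrite (ae_eq_integral (cst 1%E))//.
- by rewrite integral_cst//= probability_setT mule1.
- by apply: ge0_emeasurable_sum => // j w _ _; rewrite lee_fin.
- by apply: filterS ae_weights_total => w ->.
Qed.

(* Absolute values keep the terms nonnegative off the null set where P fails
   to be a distribution. *)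
Definition weighted_sum (phi : R -> R) (w : T) : \bar R :=
  (\sum_(j <oo) (phi (Y j w) * `|P j w|)%:E)%E.

Section weighted_sum.
Variable phi : R -> R.
Hypotheses (mphi : measurable_fun [set: R] phi) (phi0 : forall x, 0 <= phi x).
Hypothesis iX : Q.-integrable [set: T'] (fun w => (phi (X w))%:E).

Let mterm j : measurable_fun [set: T] (fun w => (phi (Y j w) * `|P j w|)%:E).
Proof.
apply/measurable_EFinP; apply: measurable_funM; exact: measurableT_comp.
Qed.

Let term_ge0 j w : (0 <= (phi (Y j w) * `|P j w|)%:E)%E.
Proof. by rewrite lee_fin mulr_ge0. Qed.

Lemma measurable_weighted_sum : measurable_fun [set: T] (weighted_sum phi).
Proof. exact: ge0_emeasurable_sum. Qed.

Lemma weighted_sum_ge0 w : (0 <= weighted_sum phi w)%E.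
Proof. exact: nneseries_ge0. Qed.

(** Termwise integration and independence factor out the common value of the integrals of
    [phi (Y j)]; the expected weights sum to 1. *)
Lemma weighted_sum_integral :
  (\int[Pr]_w weighted_sum phi w = \int[Q]_w (phi (X w))%:E)%E.
Proof.
rewrite integral_nneseries//.
under eq_eseriesr => j _.
  have [iY EY] := iid_copies_integral j hY mphi iX.
  rewrite (independent_seqs_integralM (psi := fun x => `|x|) hYP mphi _ iY)//; last first.
    exact: integrable_weight.
  rewrite EY; over.
have /fineK <- : (\int[Q]_w (phi (X w))%:E)%E \is a fin_num by exact: integrable_fin_num.
rewrite nneseriesZl; last by move=> j _; apply: integral_ge0 => w _; rewrite lee_fin.
by rewrite weights_total_integral mule1.
Qed.

Lemma weighted_sum_integrable : Pr.-integrable [set: T] (weighted_sum phi).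
Proof.
apply/integrableP; split; first exact: measurable_weighted_sum.
under eq_integral do rewrite gee0_abs ?weighted_sum_ge0//.
by rewrite weighted_sum_integral; apply: integrable_lty.
Qed.

Lemma le_weighted_sum w N :
  ((\sum_(0 <= j < N) phi (Y j w) * `|P j w|)%:E <= weighted_sum phi w)%E.
Proof. by rewrite -sumEFin; apply: nneseries_lim_ge. Qed.

End weighted_sum.

(** The weighted sum of the [|Y j|] has finite expectation, so it is finite almost everywhere and
    the series converges absolutely there. *)
Lemma ae_cvg_P_mean : Q.-integrable [set: T'] (fun w => `|X w|%:E) ->
  {ae Pr, forall w, cvgn (series (fun j => Y j w * P j w))}.
Proof.
move=> iX.
have mn : measurable_fun [set: R] (fun x : R => `|x|) by exact: measurableT_comp.
have := integrable_ae measurableT (weighted_sum_integrable mn (fun x => normr_ge0 x) iX).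
apply: filterS => w /(_ I) fin; apply: normed_cvg.
apply: nnseries_is_cvg => [j|]; first exact: normr_ge0.
rewrite [ltLHS](_ : _ = weighted_sum (fun x => `|x|) w).
  by move: fin; rewrite fin_numElt => /andP[].
by apply: eq_eseriesr => j _; rewrite /= normrM.
Qed.

(** Jensen's inequality for the truncated weights, whose total is at most 1. One null set serves all
    [N], the form needed for domination. *)
Lemma P_partial_mean_le n : {ae Pr, forall w N,
  `|\sum_(0 <= j < N) Y j w * P j w| ^+ n.+1 <=
  \sum_(0 <= j < N) `|Y j w| ^+ n.+1 * `|P j w|}.
Proof.
apply: filterS ae_weights => w [P0 P1 _] N.
apply: (@le_trans _ _ ((\sum_(0 <= j < N) P j w * `|Y j w|) ^+ n.+1)).
  rewrite lerXn2r ?nnegrE ?sumr_ge0//; first by move=> j _; rewrite mulr_ge0.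
  rewrite (le_trans (ler_norm_sum _ _ _))// ler_sum// => j _.
  by rewrite normrM (ger0_norm (P0 j)) mulrC.
apply: le_trans (expr_sum_convex _ P0 (P1 N) _) _ => //.
by apply: ler_sum => j _; rewrite (ger0_norm (P0 j)) mulrC.
Qed.

Lemma P_mean_moment_cvg n :
  Q.-integrable [set: T'] (fun w => (`|X w| ^+ n.+1)%:E) ->
  {ae Pr, forall w, cvgn (series (fun j => Y j w * P j w))} ->
  Pr.-integrable [set: T] (fun w => (P_mean P Y w ^+ n.+1)%:E) /\
  (\int[Pr]_w ((\sum_(0 <= j < N) Y j w * P j w) ^+ n.+1)%:E @[N --> \oo] -->
   \int[Pr]_w (P_mean P Y w ^+ n.+1)%:E)%E.
Proof.
move=> iX cP.
have mphi : measurable_fun [set: R] (fun x : R => `|x| ^+ n.+1).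
  by apply: measurable_funX; exact: normr_measurable.
have phi0 (x : R) : 0 <= `|x| ^+ n.+1 by rewrite exprn_ge0.
have [| | | | |? _ ?] := @dominated_convergence _ _ _ Pr setT measurableT
  (fun N w => ((\sum_(0 <= j < N) Y j w * P j w) ^+ n.+1)%:E)
  (fun w => (P_mean P Y w ^+ n.+1)%:E)
  (weighted_sum (fun x => `|x| ^+ n.+1)).
- move=> N; apply/measurable_EFinP; apply: measurable_funX; apply: measurable_sum => j.
  exact: measurable_funM.
- by apply/measurable_EFinP; apply: measurable_funX; exact: measurable_P_mean.
- apply: filterS cP => w cw _; apply: cvg_EFin; first exact: nearW.
  apply: (@cvg_comp _ _ _ _ (fun x : R => x ^+ n.+1) _ _ _ cw).
  exact: exprn_continuous.
- exact: weighted_sum_integrable.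
- apply: filterS (P_partial_mean_le n) => w Pw N _.
  rewrite (le_trans _ (le_weighted_sum phi0 w N))// lee_fin normrX; exact: Pw.
- by split.
Qed.

End P_means.

(** * Moments of the truncated sums *)

Section moment_formula.
Context d (T : measurableType d) (R : realType) (Pr : probability T R).
Context (P : nat -> {RV Pr >-> R}) (hP : random_discrete_distribution P).
Context d' (T' : measurableType d') (Q : probability T' R) (X : {RV Q >-> R}).
Context (Y : nat -> {RV Pr >-> R}) (hY : iid_copies Y X) (hYP : independent_seqs Y P).

(** The bound is [|x|^m <= 1 + |x|^n]. *)
Lemma integrable_lower_moment m n : (m <= n)%N ->
  Q.-integrable [set: T'] (fun w => (`|X w| ^+ n)%:E) ->
  Q.-integrable [set: T'] (fun w => (X w ^+ m)%:E).
Proof.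
move=> mn iX.
have i1 : Q.-integrable [set: T'] (fun w => 1 + (`|X w| ^+ n)%:E)%E.
  by apply: integrableD => //; exact: finite_measure_integrable_cst.
apply: le_integrable i1 => //.
  by apply/measurable_EFinP; exact: measurable_funX.
move=> w _; rewrite -EFinD lee_fin normrX [leRHS]ger0_norm; last first.
  by rewrite addr_ge0 ?exprn_ge0.
have [X1|X1] := leP `|X w| 1.
  by apply: (@le_trans _ _ 1); rewrite ?exprn_ile1// lerDl exprn_ge0.
by rewrite (le_trans (ler_weXn2l (ltW X1) mn))// lerDr.
Qed.

Lemma integrable_weights_prod N (j : 'I_N -> nat) (a : 'I_N -> nat) :
  Pr.-integrable [set: T] (fun w => (\prod_(i < N) P (j i) w ^+ a i)%:E).
Proof.
apply: integrable_ae_le1.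
  by apply: measurable_prod => i _; exact: measurable_funX.
apply: filterS (ae_weights hP) => w [P0 P1 _].
have Pj1 k : P k w <= 1.
  apply: le_trans (P1 k.+1); rewrite big_nat_recr//= lerDr.
  by apply: sumr_ge0.
rewrite ger0_norm; last by apply: prodr_ge0 => i _; rewrite exprn_ge0.
rewrite [leRHS](_ : 1 = \prod_(i < N) 1); last by rewrite big1.
by apply: ler_prod => i _; rewrite exprn_ge0//= exprn_ile1.
Qed.

(** Real-valued for the finite algebra below; [fine] sends infinite values to 0, so this is the true
    moment only where the integral is finite. *)
Definition moment m : R := fine (\int[Q]_w (X w ^+ m)%:E).

Definition weight_moment k (j : 'I_k -> nat) (m : 'I_k -> nat) : R :=
  fine (\int[Pr]_w (\prod_(i < k) P (j i) w ^+ m i)%:E).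

Lemma moment0 : moment 0 = 1.
Proof.
have := integral_cst Q measurableT 1%E.
by rewrite /moment /= => ->; rewrite probability_setT mule1.
Qed.

(** Independence of the two sequences separates the copies from the weights; then only the copies
    factor further, the weights being dependent in general. *)
Lemma P_partial_mean_term N n (a : 'I_N -> nat) : (forall i, (a i <= n)%N) ->
  Q.-integrable [set: T'] (fun w => (`|X w| ^+ n)%:E) ->
  Pr.-integrable [set: T] (fun w => (\prod_(i < N) (Y i w * P i w) ^+ a i)%:E) /\
  (\int[Pr]_w (\prod_(i < N) (Y i w * P i w) ^+ a i)%:E =
   (\prod_(i < N) moment (a i) * weight_moment (fun i => i) a)%:E)%E.
Proof.
move=> an iX.
(* The exponents are extended by zero to [nat], the index type that [rv_prod] expects. *)
pose b m := oapp a 0%N (insub m : option 'I_N).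
have bE (i : 'I_N) : b i = a i by rewrite /b valK.
have bn m : (b m <= n)%N by rewrite /b; case: insub.
have iXm m : (m <= n)%N -> Q.-integrable [set: T'] (fun w => (X w ^+ m)%:E).
  by move=> mn; exact: integrable_lower_moment iX.
have iY i m : (m <= n)%N ->
    Pr.-integrable [set: T] (fun w => (Y i w ^+ m)%:E) /\
    (\int[Pr]_w (Y i w ^+ m)%:E = (moment m)%:E)%E.
  move=> mn; have [] := iid_copies_integral (phi := fun x => x ^+ m) i hY _ (iXm m mn).
    exact: measurable_funX.
  move=> ? ->; split=> //; rewrite /moment fineK//.
  by apply: integrable_fin_num => //; exact: iXm.
have [|iYp EYp] := mutually_independent_integral_prod (a := b) (N := N) hY.1.
  by move=> i _; exact: (iY i _ (bn i)).1.
have iPp : Pr.-integrable [set: T] (fun w => (rv_prod P b N w)%:E).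
  by apply: eq_integrable (integrable_weights_prod (fun i : 'I_N => i) b).
have [iM EM] := indep_rv_integralM (independent_seqs_prod b b N hYP) iYp iPp.
have E w : rv_prod Y b N w * rv_prod P b N w = \prod_(i < N) (Y i w * P i w) ^+ a i.
  by rewrite /rv_prod -big_split/=; apply: eq_bigr => i _; rewrite exprMn bE.
split; first by apply: eq_integrable iM => // w _; rewrite E.
rewrite (eq_integral (fun w => (rv_prod Y b N w * rv_prod P b N w)%:E)); last first.
  by move=> w _; rewrite E.
rewrite EM EYp EFinM; congr (_ * _)%E.
  rewrite -prodEFin; apply: eq_bigr => i _.
  by rewrite (iY i _ (bn i)).2 bE.
rewrite /weight_moment.
rewrite (eq_integral (fun w => (\prod_(i < N) P i w ^+ a i)%:E)); last first.
  by move=> w _; congr EFin; apply: eq_bigr => i _; rewrite bE.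
rewrite fineK//; apply: integrable_fin_num => //.
exact: (integrable_weights_prod (fun i : 'I_N => i) a).
Qed.

Lemma P_partial_mean_moment N n : (0 < n)%N ->
  Q.-integrable [set: T'] (fun w => (`|X w| ^+ n)%:E) ->
  (\int[Pr]_w ((\sum_(0 <= j < N) Y j w * P j w) ^+ n)%:E =
  (\sum_(1 <= k < n.+1) \sum_(c : {ffun 'I_k -> 'I_n.+1} | is_composition c)
    k`!%:R^-1 * (n`!%:R / \prod_(i < k) (c i)`!%:R) *
    (\sum_(j : {ffun 'I_k -> 'I_N} | injectiveb j)
      weight_moment (fun i => j i) (fun i => c i)) *
    \prod_(i < k) moment (c i))%:E)%E.
Proof.
move=> n0 iX.
pose V (a : {ffun 'I_N -> 'I_n.+1}) : R := n`!%:R *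
  (\prod_(i < N) (moment (a i) / (a i)`!%:R) *
   weight_moment (fun i : 'I_N => i) (fun i => a i)).
transitivity ((\sum_(a : {ffun 'I_N -> 'I_n.+1} | (\sum_(i < N) a i == n)%N) V a)%:E).
  have aP (a : {ffun 'I_N -> 'I_n.+1}) := P_partial_mean_term
    (a := fun i => a i) (fun i => ltn_ord (a i)) iX.
  (* The multinomial coefficient of [a]. *)
  pose K (a : {ffun 'I_N -> 'I_n.+1}) : R := n`!%:R * \prod_(i < N) (a i)`!%:R^-1.
  under eq_integral => w _.
    rewrite big_mkord multinomial_expansion -sumEFin.
    under eq_bigr => a _.
      rewrite big_split/= mulrCA mulrC EFinM -/(K a).
      over.
    over.
  rewrite integral_sum//=; last by move=> a; apply: integrableZl => //; exact: (aP a).1.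
  rewrite -sumEFin; apply: eq_bigr => a _.
  rewrite integralZl//; last exact: (aP a).1.
  rewrite (aP a).2 -EFinM; congr EFin; rewrite /V /K big_split/=; ring.
congr EFin; rewrite sum_by_support//.
apply: eq_bigr => k _; apply: eq_bigr => c _.
rewrite mulr_sumr mulr_suml; apply: eq_bigr => j /injectiveP ij.
(* Indices off the support contribute [moment 0 / 0! = 1] here, and a zeroth power of a weight
   below. *)
rewrite /V (big_exponents _ (phi := fun _ m => moment m / m`!%:R))//; last first.
  by move=> _; rewrite moment0 divr1.
rewrite (_ : weight_moment _ _ = weight_moment (fun i => j i) (fun i => c i)).
  by rewrite big_split/= prodfV; ring.
congr fine; apply: eq_integral => w _; congr EFin.
by rewrite (big_exponents _ (phi := fun x m => P x w ^+ m)).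
Qed.

End moment_formula.

(** * Sums over injective index maps as limits of finite sums *)

Section injective_esum.
Local Open Scope ereal_scope.
Context {R : realType}.

(** [esum] is a supremum over finite subsets, and each finite subset of [D] lies in some [A N]; so
    the sum over [D] is the supremum of a nondecreasing sequence. *)
Lemma cvg_esum_exhaustion (I : choiceType) (D : set I) (A : nat -> set I)
    (a : I -> \bar R) :
  (forall N, A N `<=` D) -> {homo A : N M / (N <= M)%N >-> N `<=` M} ->
  (forall F, finite_set F -> F `<=` D -> exists N, F `<=` A N) ->
  \esum_(i in A N) a i @[N --> \oo] --> \esum_(i in D) a i.
Proof.
move=> AD Ainc AF.
have le_esum_sub (B C : set I) : B `<=` C -> \esum_(i in B) a i <= \esum_(i in C) a i.
  move=> BC; apply: ge_ereal_sup => _ [F [finF FB] <-].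
  by apply: esum_ge; exists F => //; split=> //; exact: subset_trans BC.
have -> : \esum_(i in D) a i = ereal_sup (range (fun N => \esum_(i in A N) a i)).
  apply/eqP; rewrite eq_le; apply/andP; split; last first.
    by apply: ge_ereal_sup => _ [N _ <-]; exact: le_esum_sub.
  apply: ge_ereal_sup => _ [F [finF FD] <-].
  have [N FN] := AF F finF FD.
  apply: (@le_trans _ _ (\esum_(i in A N) a i)).
    by apply: esum_ge; exists F.
  by apply: ereal_sup_ubound; exists N.
apply: ereal_nondecreasing_cvgn; apply/nondecreasing_seqP => N.
by apply: le_esum_sub; exact: Ainc.
Qed.

Lemma cvg_sum_injective k (a : {ffun 'I_k -> nat} -> \bar R) : (forall j, 0 <= a j) ->
  \sum_(j : {ffun 'I_k -> 'I_N} | injectiveb j) a [ffun i => j i : nat] @[N --> \oo] -->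
  \esum_(j in [set j : {ffun 'I_k -> nat} | injective j]) a j.
Proof.
move=> a0.
pose A N := [set j : {ffun 'I_k -> nat} | injective j /\ forall i, (j i < N)%N].
pose up N (j : {ffun 'I_k -> 'I_N}) : {ffun 'I_k -> nat} := [ffun i => j i : nat].
pose r N := [seq up N j | j <- enum (fun j : {ffun 'I_k -> 'I_N} => injectiveb j)].
have up_inj N : injective (up N).
  move=> j j' /ffunP jj'; apply/ffunP => i; apply/val_inj.
  by have := jj' i; rewrite !ffunE.
have Ar N : A N = [set` r N].
  apply/seteqP; split => [j [ij jN]|j /= /mapP[j']].
    apply/mapP; exists [ffun i => Ordinal (jN i)].
      rewrite mem_enum unfold_in; apply/injectiveP => i i'; rewrite !ffunE.
      by move=> [/ij].
    by apply/ffunP => i; rewrite !ffunE.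
  rewrite mem_enum unfold_in => /injectiveP ij' ->; split=> [i i'|i].
    by rewrite !ffunE => /val_inj /ij'.
  by rewrite ffunE.
have E N : \sum_(j : {ffun 'I_k -> 'I_N} | injectiveb j) a [ffun i => j i : nat] =
    \esum_(j in A N) a j.
  rewrite Ar esum_fset//; last exact: finite_seq.
  rewrite -fsbig_seq; last by rewrite (map_inj_uniq (@up_inj N)) enum_uniq.
  by rewrite big_map big_enum.
under eq_fun do rewrite E.
apply: cvg_esum_exhaustion.
- by move=> N j [].
- by move=> N M NM j [ij jN]; split=> // i; exact: leq_trans (jN i) NM.
- move=> F finF FD.
  (* One more than the largest value taken by the finitely many maps in [F]. *)
  exists (\max_(j <- fset_set F) \max_(i < k) (j i)).+1 => j Fj; split; first exact: FD.
  move=> i; rewrite ltnS (leq_trans (leq_bigmax i))//.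
  have jF : j \in fset_set F by rewrite in_fset_set// inE.
  by rewrite (big_rem j)//= leq_maxl.
Qed.

End injective_esum.

(** * Passage to the limit in the moment formula *)

Section moment_limit.
Context d (T : measurableType d) (R : realType) (Pr : probability T R).
Context (P : nat -> {RV Pr >-> R}) (hP : random_discrete_distribution P).

Lemma weight_momentE k (j m : 'I_k -> nat) :
  ((weight_moment P j m)%:E = \int[Pr]_w (\prod_(i < k) P (j i) w ^+ m i)%:E)%E.
Proof.
by rewrite /weight_moment fineK//; apply: integrable_fin_num => //;
  exact: integrable_weights_prod.
Qed.

Lemma weight_moment_ge0 k (j m : 'I_k -> nat) : 0 <= weight_moment P j m.
Proof.
have mp : measurable_fun [set: T] (fun w => \prod_(i < k) P (j i) w ^+ m i).
  by apply: measurable_prod => i _; exact: measurable_funX.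
(* The weights are nonnegative only almost everywhere, so the integrand is replaced by its absolute
   value. *)
rewrite /weight_moment (ae_eq_integral (fun w => `|\prod_(i < k) P (j i) w ^+ m i|%:E))//.
- by rewrite fine_ge0// integral_ge0// => w _; rewrite lee_fin.
- exact/measurable_EFinP.
- by apply/measurable_EFinP; exact: measurableT_comp.
- apply: filterS (ae_weights hP) => w [P0 _ _] _; rewrite ger0_norm//.
  by apply: prodr_ge0 => i _; rewrite exprn_ge0.
Qed.

(** Summing over all maps instead of the injective ones gives a product of [k] sums of powers of the
    weights; each sum is at most 1, as exponents at least 1 only decrease weights in [[0, 1]]. *)
Lemma sum_injective_weight_le1 k N (m : 'I_k -> nat) : (forall i, (0 < m i)%N) ->
  \sum_(j : {ffun 'I_k -> 'I_N} | injectiveb j) weight_moment P (fun i => j i) m <= 1.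
Proof.
move=> m0; rewrite -lee_fin -sumEFin.
under eq_bigr do rewrite weight_momentE.
have mp (j : {ffun 'I_k -> 'I_N}) :
    measurable_fun [set: T] (fun w => \prod_(i < k) P (j i) w ^+ m i).
  by apply: measurable_prod => i _; exact: measurable_funX.
rewrite -integral_sum//; last first.
  by move=> j; exact: (integrable_weights_prod hP (fun i => j i) m).
under eq_integral do rewrite sumEFin.
apply: integral_ae_le1.
  under eq_fun do rewrite -big_filter.
  exact: measurable_sum.
apply: filterS (ae_weights hP) => w [P0 P1 _].
have prod0 (j : {ffun 'I_k -> 'I_N}) : 0 <= \prod_(i < k) P (j i) w ^+ m i.
  by apply: prodr_ge0 => i _; rewrite exprn_ge0.
have Pj1 x : P x w <= 1.
  apply: le_trans (P1 x.+1); rewrite big_nat_recr//= lerDr.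
  by apply: sumr_ge0.
rewrite ger0_norm ?sumr_ge0//.
apply: (@le_trans _ _ (\sum_(j : {ffun 'I_k -> 'I_N}) \prod_(i < k) P (j i) w ^+ m i)).
  rewrite [leRHS](bigID (fun j : {ffun 'I_k -> 'I_N} => injectiveb j))/=.
  by rewrite lerDl sumr_ge0.
rewrite -(bigA_distr_bigA (fun i (x : 'I_N) => P x w ^+ m i)).
rewrite [leRHS](_ : 1 = \prod_(i < k) 1); last by rewrite big1.
apply: ler_prod => i _; apply/andP; split.
  by apply: sumr_ge0 => x _; rewrite exprn_ge0.
apply: le_trans (P1 N); rewrite big_mkord; apply: ler_sum => x _.
by rewrite -[leRHS]expr1 ler_wiXn2l.
Qed.

(** The truncated sums converge to the full one in the extended reals, and their uniform bound 1
    makes the limit finite, so it can be read in [R]. *)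
Lemma partition_sum_cvg k (m : 'I_k -> nat) : (forall i, (0 < m i)%N) ->
  partition_sum P m \is a fin_num /\
  (fun N => \sum_(j : {ffun 'I_k -> 'I_N} | injectiveb j)
     weight_moment P (fun i => j i) m) @ \oo --> fine (partition_sum P m).
Proof.
move=> m0.
have a0 (j : {ffun 'I_k -> nat}) : (0 <= (weight_moment P j m)%:E)%E.
  by rewrite lee_fin weight_moment_ge0.
have := cvg_sum_injective a0.
rewrite [X in _ --> X](_ : _ = partition_sum P m); last first.
  by apply: eq_esum => j _; rewrite weight_momentE expectation.unlock.
have E N : (\sum_(j : {ffun 'I_k -> 'I_N} | injectiveb j)
    (weight_moment P [ffun i => j i : nat] m)%:E)%E =
    (\sum_(j : {ffun 'I_k -> 'I_N} | injectiveb j) weight_moment P (fun i => j i) m)%:E.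
  rewrite -sumEFin; apply: eq_bigr => j _; congr EFin; congr fine.
  by apply: eq_integral => w _; congr EFin; apply: eq_bigr => i _; rewrite ffunE.
under eq_fun do rewrite E.
move=> cv.
have fin : partition_sum P m \is a fin_num.
  rewrite ge0_fin_numE; last first.
    by apply: esum_ge0 => j _; rewrite expectation.unlock -weight_momentE.
  apply: le_lt_trans (ltry 1); rewrite -(cvg_lim _ cv)//.
  apply: lime_le; first exact: cvgP cv.
  by apply: nearW => N; rewrite lee_fin sum_injective_weight_le1.
split=> //; move: cv; rewrite -[partition_sum P m]fineK// => /fine_cvgP[_].
by rewrite fineK.
Qed.

Context d' (T' : measurableType d') (Q : probability T' R) (X : {RV Q >-> R}).
Context (Y : nat -> {RV Pr >-> R}) (hY : iid_copies Y X) (hYP : independent_seqs Y P).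

(** The sums over [k] and [c] are finite and do not depend on [N]; only the innermost sum over
    numberings moves. *)
Lemma P_partial_mean_moment_cvg n : (0 < n)%N ->
  Q.-integrable [set: T'] (fun w => (`|X w| ^+ n)%:E) ->
  (\int[Pr]_w ((\sum_(0 <= j < N) Y j w * P j w) ^+ n)%:E @[N --> \oo] -->
   ECPF_moment P X n)%E.
Proof.
move=> n0 iX.
under eq_fun do rewrite (P_partial_mean_moment hP hY hYP)//.
have mX m : (m <= n)%N -> ('E_Q[fun w => (X w ^+ m)%R] = (moment X m)%:E)%E.
  move=> mn; rewrite expectation.unlock /moment fineK//; apply: integrable_fin_num => //.
  exact: integrable_lower_moment mn iX.
have -> : ECPF_moment P X n =
    (\sum_(1 <= k < n.+1) \sum_(c : {ffun 'I_k -> 'I_n.+1} | is_composition c)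
    k`!%:R^-1 * (n`!%:R / \prod_(i < k) (c i)`!%:R) *
    fine (partition_sum P (fun i => c i : nat)) * \prod_(i < k) moment X (c i))%:E.
  rewrite -sumEFin; apply: eq_bigr => k _; rewrite -sumEFin; apply: eq_bigr => c.
  move=> /andP[/forallP c0 /eqP cn].
  have [fin _] := partition_sum_cvg c0.
  rewrite /ECPF cn [RHS]EFinM [in RHS](EFinM _ (fine _)) fineK// -prodEFin.
  congr (_ * _)%E.
  by apply: eq_bigr => i _; rewrite mX// -ltnS.
apply: cvg_EFin; first exact: nearW.
rewrite /comp/=; apply: cvg_big => [|k _]; first exact: add_continuous.
apply: cvg_big => [|c /andP[/forallP c0 _]]; first exact: add_continuous.
apply: cvgMl; apply: cvgMr.
exact: (partition_sum_cvg c0).2.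
Qed.

Lemma P_mean_moment n : (0 < n)%N ->
  Q.-integrable [set: T'] (fun w => (`|X w| ^+ n)%:E) ->
  [/\ {ae Pr, forall w, cvgn (series (fun j => Y j w * P j w))},
      Pr.-integrable [set: T] (fun w => (P_mean P Y w ^+ n)%:E) &
      (\int[Pr]_w (P_mean P Y w ^+ n)%:E = ECPF_moment P X n)%E].
Proof.
move=> n0 iX.
have cP : {ae Pr, forall w, cvgn (series (fun j => Y j w * P j w))}.
  apply: (ae_cvg_P_mean hP hY hYP); apply: integrable_norm.
  by apply: eq_integrable (integrable_lower_moment n0 iX) => // w _; rewrite expr1.
have cv := P_partial_mean_moment_cvg n0 iX.
(* The domination was stated for exponents of the form [n.+1]. *)
case: n n0 iX cv => // n n0 iX cv.
have [iM cM] := P_mean_moment_cvg hP hY hYP iX cP.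
split=> //.
by rewrite -(cvg_lim _ cv)// -(cvg_lim _ cM).
Qed.

End moment_limit.

(** * Exponential moments of the P-mean *)

Section exponential_moments.
Context d (T : measurableType d) (R : realType) (Pr : probability T R).
Context (P : nat -> {RV Pr >-> R}) (hP : random_discrete_distribution P).
Context d' (T' : measurableType d') (Q : probability T' R) (X : {RV Q >-> R}).
Context (Y : nat -> {RV Pr >-> R}) (hY : iid_copies Y X) (hYP : independent_seqs Y P).

Lemma measurable_expRM (t : R) : measurable_fun [set: R] (fun x => expR (t * x)).
Proof. by apply: measurableT_comp => //; exact: measurable_funM. Qed.

(** Jensen's inequality with infinitely many weights: the tangents at the P-mean [m], summed over
    [j < N], stay below the weighted sum, and their linear part vanishes as [N] grows. *)
Lemma ae_expR_P_mean_le t :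
  {ae Pr, forall w, cvgn (series (fun j => Y j w * P j w))} ->
  {ae Pr, forall w, ((expR (t * P_mean P Y w))%:E <=
                     weighted_sum P Y (fun x => expR (t * x)) w)%E}.
Proof.
move=> cP; apply: filterS2 (ae_weights hP) cP => w [P0 _ P1] cw.
set m := P_mean P Y w.
pose q N := \sum_(0 <= j < N) P j w.
pose S N := \sum_(0 <= j < N) Y j w * P j w.
have cv : (expR (t * m) * (q N + t * (S N - m * q N)))%:E @[N --> \oo] -->
    (expR (t * m))%:E.
  apply: cvg_EFin; first exact: nearW.
  have : expR (t * m) * (q N + t * (S N - m * q N)) @[N --> \oo] -->
      expR (t * m) * (1 + t * (m - m * 1)).
    apply: cvgMr; apply: cvgD; first exact: P1.
    by apply: cvgMr; apply: cvgB; [exact: cw|apply: cvgMr; exact: P1].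
  by rewrite mulr1 subrr mulr0 addr0 mulr1.
rewrite -(cvg_lim _ cv)//; apply: lime_le; first exact: cvgP cv.
apply: nearW => N.
apply: le_trans (le_weighted_sum P Y (fun x => expR_ge0 (t * x)) w N).
rewrite lee_fin /q /S [leLHS](_ : _ =
    \sum_(0 <= j < N) expR (t * m) * (1 + t * (Y j w - m)) * P j w).
  apply: ler_sum => j _; rewrite (ger0_norm (P0 j)) ler_wpM2r//.
  exact: expR_tangent_le.
rewrite mulr_sumr -sumrB mulr_sumr -big_split/= mulr_sumr.
by apply: eq_bigr => j _; ring.
Qed.

Lemma expR_P_mean_integral_le t :
  {ae Pr, forall w, cvgn (series (fun j => Y j w * P j w))} ->
  Q.-integrable [set: T'] (fun w => (expR (t * X w))%:E) ->
  (\int[Pr]_w (expR (t * P_mean P Y w))%:E <= \int[Q]_w (expR (t * X w))%:E)%E.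
Proof.
move=> cP iX.
rewrite -(weighted_sum_integral hP hY hYP (measurable_expRM t) _ iX); last first.
  by move=> x; exact: expR_ge0.
apply: ae_ge0_le_integral => //.
- apply/measurable_EFinP; apply: (measurableT_comp (measurable_expRM t)).
  exact: measurable_P_mean.
- by move=> w _; apply: weighted_sum_ge0 => x; exact: expR_ge0.
- by apply: measurable_weighted_sum => [|x]; [exact: measurable_expRM|exact: expR_ge0].
- by apply: filterS (ae_expR_P_mean_le t cP).
Qed.

Lemma mmt_gen_funE d0 (T0 : measurableType d0) (Q0 : probability T0 R) (Z : T0 -> R) t :
  ('M_Q0 Z t = \int[Q0]_w (expR (t * Z w))%:E)%E.
Proof.
rewrite /mmt_gen_fun expectation.unlock; apply: eq_integral => w _.
by rewrite /= mulrC.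
Qed.

Lemma mmt_gen_fun_lty_integrable t : ('M_Q X t < +oo)%E ->
  Q.-integrable [set: T'] (fun w => (expR (t * X w))%:E).
Proof.
rewrite mmt_gen_funE => h; apply/integrableP; split.
  by apply/measurable_EFinP; exact: (measurableT_comp (measurable_expRM t)).
by under eq_integral do rewrite gee0_abs ?lee_fin ?expR_ge0//.
Qed.

(** A power is bounded by a multiple of [expR (s |x|)], hence of [expR (s x) + expR (- s x)]. *)
Lemma mmt_gen_fun_lty_moments s n : 0 < s ->
  ('M_Q X s < +oo)%E -> ('M_Q X (- s) < +oo)%E ->
  Q.-integrable [set: T'] (fun w => (`|X w| ^+ n)%:E).
Proof.
move=> s0 /mmt_gen_fun_lty_integrable i1 /mmt_gen_fun_lty_integrable i2.
have [K K0 HK] := horner_le_expR 'X^n s0.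
apply: le_integrable (integrableZl _ K (integrableD _ i1 i2)) => //.
  by apply/measurable_EFinP; apply: measurable_funX; exact: measurableT_comp.
move=> w _; rewrite /= lee_fin -normrX -hornerXn normr_id.
rewrite (le_trans (HK _))// (le_trans _ (ler_norm _))// ler_wpM2l//.
have := expR_norm_le (s * X w).
by rewrite normrM (gtr0_norm s0) mulNr.
Qed.

(** The bound on the moment generating function at [s] and [- s] gives the law of the P-mean an
    exponential moment. *)
Lemma P_mean_determined s : 0 < s ->
  {ae Pr, forall w, cvgn (series (fun j => Y j w * P j w))} ->
  ('M_Q X s < +oo)%E -> ('M_Q X (- s) < +oo)%E ->
  determined_by_moments (distribution Pr (P_mean P Y)).
Proof.
move=> s0 cP h1 h2.
have i1 := mmt_gen_fun_lty_integrable h1; have i2 := mmt_gen_fun_lty_integrable h2.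
apply: (exp_moment_determined s0); apply/exp_moment_ltyP => //.
have mt t : measurable_fun [set: T] (fun w => (expR (t * P_mean P Y w))%:E).
  apply/measurable_EFinP; apply: (measurableT_comp (measurable_expRM t)).
  exact: measurable_P_mean.
rewrite ge0_integral_distribution; last 2 first.
- apply/measurable_EFinP; apply: measurable_funD; first exact: measurable_expRM.
  by under eq_fun do rewrite -mulNr; exact: measurable_expRM.
- by move=> x; rewrite lee_fin addr_ge0 ?expR_ge0.
rewrite (eq_integral (fun w => (expR (s * P_mean P Y w))%:E +
    (expR (- s * P_mean P Y w))%:E)%E); last by move=> w _; rewrite /= mulNr.
rewrite ge0_integralD//; try by move=> w _; rewrite lee_fin expR_ge0.
apply: lte_add_pinfty.
  by apply: le_lt_trans (expR_P_mean_integral_le cP i1) _; rewrite -mmt_gen_funE.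
by apply: le_lt_trans (expR_P_mean_integral_le cP i2) _; rewrite -mmt_gen_funE.
Qed.

End exponential_moments.

Theorem corollary22 (R : realType)
    (d : measure_display) (T : measurableType d) (Pr : probability T R)
    (P : nat -> {RV Pr >-> R}) (hP : random_discrete_distribution P)
    (d' : measure_display) (T' : measurableType d') (Q : probability T' R)
    (X : {RV Q >-> R})
    (Y : nat -> {RV Pr >-> R}) (hY : iid_copies Y X)
    (hYP : independent_seqs Y P) :
  (forall n : nat, (0 < n)%N ->
     ('E_Q[fun w => (`|X w| ^+ n)%R] < +oo)%E ->
     [/\ {ae Pr, forall w, cvgn (series (fun j => Y j w * P j w))},
         ('E_Pr[fun w => (`|P_mean P Y w| ^+ n)%R] < +oo)%E
       & ('E_Pr[fun w => (P_mean P Y w ^+ n)%R] = ECPF_moment P X n)%E])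
  /\
  (forall I : set R, open I -> is_interval I -> I 0 ->
     (forall t, I t -> ('M_Q X t < +oo)%E) ->
     (forall t, I t ->
        ('M_Pr (P_mean P Y) t <= 'M_Q X t)%E /\ ('M_Q X t < +oo)%E)
     /\
     ((forall n : nat, (0 < n)%N ->
         ('E_Pr[fun w => (P_mean P Y w ^+ n)%R] = ECPF_moment P X n)%E)
      /\ determined_by_moments (distribution Pr (P_mean P Y)))).
Proof.
split=> [n n0|I oI _ I0 hI].
  rewrite !expectation.unlock => hX.
  have iX : Q.-integrable [set: T'] (fun w => (`|X w| ^+ n)%:E).
    apply/integrableP; split.
      by apply/measurable_EFinP; apply: measurable_funX; exact: measurableT_comp.
    by under eq_integral do rewrite gee0_abs ?lee_fin ?exprn_ge0//.
  have [cP /integrableP[_ iP] EP] := P_mean_moment hP hY hYP n0 iX.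
  split=> //; move: iP; apply: le_lt_trans.
  by under eq_integral do rewrite -normrX.
(* Half the radius of a ball around 0 inside [I], so that both tails of [X] are controlled. *)
have [s s0 [Is INs]] : exists2 s, 0 < s & I s /\ I (- s).
  have /nbhs_ballP[e /= e0 Ie] : nbhs 0 I by exact: open_nbhs_nbhs.
  have e2 : 0 < e / 2 by rewrite divr_gt0.
  exists (e / 2) => //; split; apply: Ie; rewrite -ball_normE/= sub0r ?opprK ?normrN;
    rewrite gtr0_norm//; lra.
have iX n := mmt_gen_fun_lty_moments n s0 (hI _ Is) (hI _ INs).
(* The case [n = 1] is invoked only for the almost sure convergence of the series. *)
have [cP _ _] := P_mean_moment hP hY hYP (ltn0Sn 0) (iX 1%N).
split=> [t It|].
  split; last exact: hI.
  rewrite !mmt_gen_funE; apply: (expR_P_mean_integral_le hP hY hYP cP).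
  exact: mmt_gen_fun_lty_integrable (hI t It).
split=> [n n0|].
  by rewrite expectation.unlock; have [] := P_mean_moment hP hY hYP n0 (iX n).
exact: (P_mean_determined hP hY hYP s0 cP (hI _ Is) (hI _ INs)).
Qed.
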